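(* Let $V$ be a complete discrete valuation ring with uniformizer $\pi$ and residue field $\kappa$, let $V[[\underline x]]=V[[x_1,\dots,x_n]]$ with maximal ideal $\mathfrak m_V=\langle\pi,x_1,\dots,x_n\rangle$, and let $f\in\mathfrak m_V$. Then the following are equivalent: (1) $V[[\underline x]]/\langle f\rangle$ is a regular local ring; (2) $f$ is of order $1$; (3) $f\sim x_1$; (4) $\tau_V(f)=0$.
   Context: The order of $f$ is the largest $k$ with $f\in\mathfrak m_V^k$. Every nonzero $a\in V$ is uniquely $u\pi^m$ with $u\in V$ a unit, $m\ge0$. For $f=\sum_\alpha a_\alpha\underline x^\alpha$, write each nonzero $a_\alpha=u_\alpha\pi^{n_\alpha}$ and put $\tilde f=\sum_{a_\alpha\ne0}u_\alpha y^{n_\alpha}\underline x^\alpha\in V[[\underline x,y]]$. $J(\tilde f)$ is the ideal generated by the partial derivatives of $\tilde f$ with respect to $x_1,\dots,x_n,y$. $f\sim g$ means that $V[[\underline x,y]]/\langle\tilde f\rangle\cong V[[\underline x,y]]/\langle\tilde g\rangle$ as $V$-algebras. Let $B=V[[\underline x,y]]/(\langle\tilde f\rangle+J(\tilde f))$. If $B$ is one-dimensional, $\tau_V(f)=\operatorname{length}_{V[[\underline x,y]]}\big(V[[\underline x,y]]/(J(\tilde f)+\langle\tilde f,a\rangle)\big)$, where $a\in V[[\underline x,y]]$ is such that its image in $B$ generates a minimal reduction of the maximal ideal of $B$ (the length equals the multiplicity of $B$ and does not depend on $a$). If $B=0$, $\tau_V(f)=0$. Otherwise $\tau_V(f)=\infty$.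 (An ideal $J\subset I$ is a minimal reduction of $I$ if $JI^N=I^{N+1}$ for some $N$ and no ideal strictly contained in $J$ has this property.)
   Formalization: The formal statement assumes f ≠ 0 (and n ≥ 1, so that x_1 exists): for f = 0 the ring V[[x]]/⟨f⟩ = V[[x]] is regular while f does not have order 1, f is not equivalent to x_1, and τ_V(f) = ∞. *)

(* Defs.v *)
From HB Require Import structures.
From mathcomp Require Import all_boot all_order all_algebra.
From mathcomp Require Import boolp classical_sets mpoly.

Set Implicit Arguments.
Unset Strict Implicit.
Unset Printing Implicit Defensive.

Import GRing.Theory.
Local Open Scope ring_scope.
Local Open Scope classical_set_scope.

(* Suprema in nat + {oo}: [None] stands for oo.  The supremum of the empty set
   is left undefined (no [t] satisfies the predicate). *)
Definition is_sup_nat (P : set nat) (t : option nat) : Prop :=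
  match t with
  | Some k => P k /\ forall j, P j -> (j <= k)%N
  | None => forall N, exists2 k, P k & (N <= k)%N
  end.

Section Ideals.
Variable R : comPzRingType.
Implicit Types I J M : set R.

Definition is_ideal I : Prop :=
  [/\ I 0, forall x y, I x -> I y -> I (x + y) & forall a x, I x -> I (a * x)].

Definition is_prime I : Prop :=
  [/\ is_ideal I, ~ I 1 & forall x y, I (x * y) -> I x \/ I y].

Definition is_maximal M : Prop :=
  [/\ is_ideal M, M <> setT
    & forall J, is_ideal J -> M `<=` J -> J = M \/ J = setT].

(* [R] is local with maximal ideal [M] *)
Definition is_local M : Prop :=
  is_maximal M /\ forall M', is_maximal M' -> M' = M.

Record ideal := Ideal { ideal_set :> set R; idealP : is_ideal ideal_set }.

Lemma smallest_is_ideal (S : set R) : is_ideal (smallest is_ideal S).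
Proof.
split.
- by move=> I [[]].
- move=> x y Sx Sy I SI; case: (SI) => -[_ ID _] _.
  by apply: ID; [exact: Sx|exact: Sy].
- by move=> a x Sx I SI; case: (SI) => -[_ _ IM] _; apply: IM; exact: Sx.
Qed.

Definition ideal_gen (S : set R) : ideal := Ideal (smallest_is_ideal S).

Definition ideal_mul I J : ideal :=
  ideal_gen [set z | exists x y, [/\ I x, J y & z = x * y]].

Fixpoint ideal_pow I (k : nat) : set R :=
  if k is k'.+1 then ideal_mul I (ideal_pow I k') else setT.

Definition noetherian : Prop :=
  forall I, is_ideal I -> exists s : seq R, I = ideal_gen [set x | x \in s].

Definition prime_chain (k : nat) (c : nat -> set R) : Prop :=
  (forall i, (i <= k)%N -> is_prime (c i)) /\
  (forall i, (i < k)%N -> c i `<` c i.+1).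

(* no [d] works for the zero ring *)
Definition has_krull_dim (d : option nat) : Prop :=
  is_sup_nat [set k | exists c, prime_chain k c] d.

Definition regular_local_ring : Prop :=
  noetherian /\
  exists M d, [/\ is_local M, has_krull_dim (Some d)
                & exists z : 'I_d -> R, M = ideal_gen (range z)].

(* complete and separated for the I-adic topology *)
Definition adically_complete I : Prop :=
  (forall x, (forall k, ideal_pow I k x) -> x = 0) /\
  (forall s : nat -> R,
    (forall k, exists N, forall i j, (N <= i)%N -> (N <= j)%N ->
       ideal_pow I k (s i - s j)) ->
    exists l, forall k, exists N, forall i, (N <= i)%N ->
       ideal_pow I k (s i - l)).

Definition is_reduction J I : Prop :=
  [/\ is_ideal J, J `<=` I
    & exists N, ideal_mul J (ideal_pow I N) = ideal_pow I N.+1 :> set R].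

Definition is_minimal_reduction J I : Prop :=
  is_reduction J I /\ forall J', J' `<` J -> ~ is_reduction J' I.

End Ideals.

Arguments noetherian : clear implicits.
Arguments regular_local_ring : clear implicits.
Arguments has_krull_dim : clear implicits.

Section Length.
Variables (R : pzRingType) (M : lmodType R).

Definition is_submodule (N : set M) : Prop :=
  [/\ N 0, forall u v, N u -> N v -> N (u + v)
    & forall (a : R) u, N u -> N (a *: u)].

Definition submodule_chain (k : nat) (c : nat -> set M) : Prop :=
  [/\ c 0%N = [set 0], c k = setT,
      forall i, (i <= k)%N -> is_submodule (c i)
    & forall i, (i < k)%N -> c i `<` c i.+1].

Definition has_length (t : option nat) : Prop :=
  is_sup_nat [set k | exists c, submodule_chain k c] t.

End Length.

Arguments has_length R M t : clear implicits.

(* The quotient R/I, possibly the zero ring (hence no use of [idealr], which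
   only covers proper ideals), as a commutative ring and as an R-module. *)
Section Quotient.
Local Open Scope quotient_scope.
Variables (R : comPzRingType) (I : ideal R).

Definition ideal_pred : {pred R} := fun x => `[< ideal_set I x >].

Lemma ideal_pred_zmod : zmod_closed ideal_pred.
Proof.
case: (idealP I) => I0 ID IM; split; first exact/asboolP.
move=> x y /asboolP Ix /asboolP Iy; apply/asboolP.
by apply: ID => //; rewrite -mulN1r; exact: IM.
Qed.

HB.instance Definition _ := GRing.isZmodClosed.Build R ideal_pred
  ideal_pred_zmod.

Definition quo : Type := Quotient.quot ideal_pred.
HB.instance Definition _ := GRing.Zmodule.on quo.
HB.instance Definition _ := EqQuotient.on quo.

Definition quo_proj (x : R) : quo := \pi_quo x.
Local Notation p := quo_proj.

Lemma quo_projK (u : quo) : p (repr u) = u. Proof. exact: reprK. Qed.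

Lemma quo_eqP (x y : R) : p x = p y <-> ideal_set I (x - y).
Proof.
split=> [/eqP|H].
  by rewrite -Quotient.idealrBE => /asboolP.
by apply/eqP; rewrite -Quotient.idealrBE; apply/asboolP.
Qed.

Lemma quo_projD : {morph p : x y / x + y}.
Proof. exact: Quotient.pi_add. Qed.

Definition quo_mul (u v : quo) : quo := p (repr u * repr v).
Definition quo_scale (a : R) (u : quo) : quo := p (a * repr u).

Lemma quo_projM x y : p (x * y) = quo_mul (p x) (p y).
Proof.
apply/quo_eqP; case: (idealP I) => I0 ID IM.
have /quo_eqP Hx : p x = p (repr (p x)) by rewrite quo_projK.
have /quo_eqP Hy : p y = p (repr (p y)) by rewrite quo_projK.
set x' := repr (p x) in Hx *; set y' := repr (p y) in Hy *.
have -> : x * y - x' * y' = y * (x - x') + x' * (y - y').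
  by rewrite !mulrBr (mulrC y) (mulrC y x') addrA addrNK.
by apply: ID; apply: IM.
Qed.

Lemma quo_projZ a x : p (a * x) = quo_scale a (p x).
Proof.
apply/quo_eqP; case: (idealP I) => I0 ID IM.
by rewrite -mulrBr; apply: IM; apply/quo_eqP; rewrite quo_projK.
Qed.

Lemma quo_mulA : associative quo_mul.
Proof.
move=> u v w; rewrite -(quo_projK u) -(quo_projK v) -(quo_projK w).
by rewrite -!quo_projM mulrA.
Qed.

Lemma quo_mulC : commutative quo_mul.
Proof. by move=> u v; rewrite /quo_mul mulrC. Qed.

Lemma quo_mul1 : left_id (p 1) quo_mul.
Proof. by move=> u; rewrite -(quo_projK u) -quo_projM mul1r. Qed.

Lemma quo_mulDl : left_distributive quo_mul +%R.
Proof.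
move=> u v w; rewrite -(quo_projK u) -(quo_projK v) -(quo_projK w).
by rewrite -quo_projD -!quo_projM -quo_projD mulrDl.
Qed.

HB.instance Definition _ :=
  GRing.Zmodule_isComPzRing.Build quo quo_mulA quo_mulC quo_mul1 quo_mulDl.

Lemma quo_scaleA a b u : quo_scale a (quo_scale b u) = quo_scale (a * b) u.
Proof. by rewrite -(quo_projK u) -!quo_projZ mulrA. Qed.

Lemma quo_scale1 : left_id 1 quo_scale.
Proof. by move=> u; rewrite -(quo_projK u) -!quo_projZ mul1r. Qed.

Lemma quo_scaleDr : right_distributive quo_scale +%R.
Proof.
move=> a u v; rewrite -(quo_projK u) -(quo_projK v).
by rewrite -quo_projD -!quo_projZ -quo_projD mulrDr.
Qed.

Lemma quo_scaleDl u : {morph quo_scale^~ u : a b / a + b}.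
Proof.
by move=> a b; rewrite -(quo_projK u) -!quo_projZ -quo_projD mulrDl.
Qed.

HB.instance Definition _ := GRing.Zmodule_isLmodule.Build R quo
  quo_scaleA quo_scale1 quo_scaleDr quo_scaleDl.

End Quotient.

(* The formal power series ring R[[x_0, ..., x_{n-1}]]. *)
Record fps (n : nat) (R : Type) := Fps { fps_coef :> 'X_{1..n} -> R }.

Section PowerSeries.
Variables (n : nat) (R : comNzRingType).
Local Notation S := (fps n R).
Implicit Types f g h : S.

HB.instance Definition _ := gen_eqMixin S.
HB.instance Definition _ := gen_choiceMixin S.

Lemma fpsP f g : f =1 g -> f = g.
Proof. by case: f g => [f] [g] /funext /= ->. Qed.

Definition fps_zero : S := Fps (fun=> 0).
Definition fps_opp f : S := Fps (fun m => - f m).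
Definition fps_add f g : S := Fps (fun m => f m + g m).
Definition fps_one : S := Fps (fun m => (m == 0%MM)%:R).

Definition fps_mul f g : S := Fps (fun m =>
  \sum_(k : 'X_{1..n < (mdeg m).+1, (mdeg m).+1} | m == (k.1 + k.2)%MM)
     f k.1 * g k.2).

Fact fps_addA : associative fps_add.
Proof. by move=> f g h; apply: fpsP => m /=; rewrite addrA. Qed.
Fact fps_addC : commutative fps_add.
Proof. by move=> f g; apply: fpsP => m /=; rewrite addrC. Qed.
Fact fps_add0 : left_id fps_zero fps_add.
Proof. by move=> f; apply: fpsP => m /=; rewrite add0r. Qed.
Fact fps_addN : left_inverse fps_zero fps_opp fps_add.
Proof. by move=> f; apply: fpsP => m /=; rewrite addNr. Qed.

HB.instance Definition _ :=
  GRing.isZmodule.Build S fps_addA fps_addC fps_add0 fps_addN.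

(* The ring axioms are inherited from {mpoly R[n]} through truncation. *)
Definition fps_trunc (d : nat) f : {mpoly R[n]} :=
  \sum_(m : 'X_{1..n < d}) f m *: 'X_[m].

Lemma fps_truncE d f m : (mdeg m < d)%N -> (fps_trunc d f)@_m = f m.
Proof. exact: mcoeff_mpoly. Qed.

Lemma fps_mulE p q f g m :
  (forall k, (mdeg k <= mdeg m)%N -> p@_k = f k) ->
  (forall k, (mdeg k <= mdeg m)%N -> q@_k = g k) ->
  fps_mul f g m = (p * q)@_m.
Proof.
move=> pf qg; rewrite mcoeffM /=; apply: eq_bigr => k _.
by rewrite pf ?qg // -ltnS bmdeg.
Qed.

Fact fps_mulA : associative fps_mul.
Proof.
move=> f g h; apply: fpsP => m; set d := (mdeg m).+1.
have tr k u : (mdeg k <= mdeg m)%N -> (fps_trunc d u)@_k = u k.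
  by move=> km; rewrite fps_truncE.
have trM k u v : (mdeg k <= mdeg m)%N ->
    (fps_trunc d u * fps_trunc d v)@_k = fps_mul u v k.
  move=> km; rewrite (@fps_mulE (fps_trunc d u) (fps_trunc d v)) //;
  by move=> l lk; apply: tr; exact: leq_trans km.
rewrite (@fps_mulE (fps_trunc d f) (fps_trunc d g * fps_trunc d h)).
- rewrite (@fps_mulE (fps_trunc d f * fps_trunc d g) (fps_trunc d h)).
  + by rewrite mulrA.
  + by move=> k /trM ->.
  + by move=> k /tr ->.
- by move=> k /tr ->.
- by move=> k /trM ->.
Qed.

Fact fps_mulC : commutative fps_mul.
Proof.
move=> f g; apply: fpsP => m; set d := (mdeg m).+1.
have tr u k : (mdeg k <= mdeg m)%N -> (fps_trunc d u)@_k = u k.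
  by move=> km; rewrite fps_truncE.
by rewrite (fps_mulE (tr f) (tr g)) (fps_mulE (tr g) (tr f)) mulrC.
Qed.

Fact fps_mul1 : left_id fps_one fps_mul.
Proof.
move=> f; apply: fpsP => m; set d := (mdeg m).+1.
have tr u k : (mdeg k <= mdeg m)%N -> (fps_trunc d u)@_k = u k.
  by move=> km; rewrite fps_truncE.
rewrite (@fps_mulE 1 (fps_trunc d f)) ?mul1r ?tr //; last exact: tr.
by move=> k _; rewrite mcoeff1.
Qed.

Fact fps_mulDl : left_distributive fps_mul +%R.
Proof.
move=> f g h; apply: fpsP => m /=; rewrite -big_split /=.
by apply: eq_bigr => k _; rewrite mulrDl.
Qed.

Fact fps_one_neq0 : fps_one != 0.
Proof.
apply/eqP => /(congr1 (fun u : S => u 0%MM)) /=.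
by rewrite eqxx; exact/eqP/oner_neq0.
Qed.

HB.instance Definition _ := GRing.Zmodule_isComNzRing.Build S
  fps_mulA fps_mulC fps_mul1 fps_mulDl fps_one_neq0.

Definition fpsC (c : R) : S := Fps (fun m => if m == 0%MM then c else 0).

Definition fpsX (i : 'I_n) : S := Fps (fun m => (m == U_(i)%MM)%:R).

Definition fps_deriv (i : 'I_n) f : S :=
  Fps (fun m => f (m + U_(i))%MM *+ (m i).+1).

End PowerSeries.

(* [V] is a complete discrete valuation ring (a principal ideal domain with a
   unique maximal ideal, not a field, complete) with uniformizer [pi]. *)
Definition complete_dvr (V : idomainType) (pi : V) : Prop :=
  [/\ forall I : set V, is_ideal I -> exists a, I = ideal_gen [set a],
      is_local (ideal_gen [set pi]),
      pi <> 0
    & adically_complete (ideal_gen [set pi])].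

Section Hypersurface.
Variables (V : idomainType) (pi : V) (n : nat).
Implicit Types f g : fps n V.

Definition fps_max_ideal : ideal (fps n V) :=
  ideal_gen (fpsC n pi |` range (@fpsX n V)).

(* The order of [f]; it is oo for f = 0. *)
Definition has_order f (t : option nat) : Prop :=
  is_sup_nat [set k | ideal_pow fps_max_ideal k f] t.

(* V[[x, y]] is [fps n.+1 V]: the variable x_i has index [widen_ord _ i] and y
   has index [ord_max].  The monomial [m] stands for x^(mnm_x m) y^(m ord_max). *)
Definition mnm_x (m : 'X_{1..n.+1}) : 'X_{1..n} :=
  [multinom m (widen_ord (leqnSn n) i) | i < n].

(* The coefficient of x^a y^k in f~ is the unit u if f_a = u pi^k, and it is 0
   if there is no such unit, i.e. if f_a = 0 or k <> n_a. *)
Definition fps_tilde f : fps n.+1 V := Fps (fun m =>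
  xget 0 [set u : V | u \is a GRing.unit /\
                      f (mnm_x m) = u * pi ^+ (m ord_max)]).

(* J(f~) *)
Definition jacobian f : ideal (fps n.+1 V) :=
  ideal_gen (range (fun i => fps_deriv i (fps_tilde f))).

(* <f~> + J(f~) *)
Definition tjurina_ideal f : ideal (fps n.+1 V) :=
  ideal_gen (jacobian f `|` [set fps_tilde f]).

(* f ~ g: isomorphism of V-algebras, i.e. a ring isomorphism compatible with the
   structure maps from V. *)
Definition fps_sim f g : Prop :=
  let pf := quo_proj (ideal_gen [set fps_tilde f]) in
  let pg := quo_proj (ideal_gen [set fps_tilde g]) in
  exists phi : {rmorphism quo (ideal_gen [set fps_tilde f]) ->
                          quo (ideal_gen [set fps_tilde g])},
    bijective phi /\ forall c : V, phi (pf (fpsC n.+1 c)) = pg (fpsC n.+1 c).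

(* The image of [a] in B = V[[x, y]]/(<f~> + J(f~)) generates a minimal
   reduction of the maximal ideal of B. *)
Definition gen_minimal_reduction f (a : fps n.+1 V) : Prop :=
  exists2 M : set (quo (tjurina_ideal f)), is_local M &
    is_minimal_reduction (ideal_gen [set quo_proj (tjurina_ideal f) a]) M.

(* tau_V(f) = t, where [None] stands for oo.  In the one-dimensional case the
   length is independent of [a]; it has no value if there is no such [a]. *)
Definition has_tau f (t : option nat) : Prop :=
  let B : comPzRingType := quo (tjurina_ideal f) in
  [\/ (0 = 1 :> B) /\ t = Some 0%N,
      has_krull_dim B (Some 1%N) /\
      (exists2 a, gen_minimal_reduction f a &
        has_length (fps n.+1 V)
          (quo (ideal_gen (jacobian f `|` [set fps_tilde f; a]))) t)
    | [/\ 0 <> 1 :> B, ~ has_krull_dim B (Some 1%N) & t = None]].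

End Hypersurface.

(* Main.v *)
(* The quotient V[[x]]/f is regular iff f is not in m^2: dim V[[x]]/f = n by
   Krull's principal ideal theorem, while m/f needs n + 1 generators if f is in
   m^2, and n suffice otherwise because f can replace one of pi, x_1, ..., x_n.
   Moreover f lies outside m^2 iff some linear coefficient of f~ is a unit (a
   unit multiple of pi in f(0) becomes a unit coefficient of y).  In that case
   Weierstrass division by f~, of degree 1 in the corresponding variable z,
   identifies V[[x,y]]/f~ with the series not involving z, and the partial
   derivative of f~ with respect to z is a unit.  Otherwise f~ is in the square
   of the maximal ideal, so that V[[x,y]]/f~ has a larger embedding dimension
   than V[[x,y]]/x_1, and f~ and all its derivatives lie in the maximal ideal,
   so that B <> 0. *)

Require Import Defs.
From HB Require Import structures.
From mathcomp Require Import all_boot all_order all_algebra.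
From mathcomp Require Import boolp classical_sets mpoly.
From mathcomp Require Import ring zify perm.

Set Implicit Arguments.
Unset Strict Implicit.
Unset Printing Implicit Defensive.

Import Order.TTheory GRing.Theory.
Local Open Scope ring_scope.
Local Open Scope classical_set_scope.

(** * Ideals, saturation and chain conditions *)

(** Dimension theory is built from ideals and chains of primes alone. Krull's argument lives in a
    localization R_P modulo a prime; here no localization is formed, and statements about R_P become
    statements about ideals of R up to a factor outside P. The cotangent space M/M^2 is handled in
    the same spirit: a family is independent when its combinations lying in M^2 have all
    coefficients in M, and dimensions are compared by multiplying matrices over R/M. Inversion of
    series and linear Weierstrass division are both fixed points of a contraction, for two different
    weights on monomials: the total degree, and the degree in all variables but one. The second
    weight is zero on infinitely many monomials, so limits are taken coefficient by coefficient.
    Every coefficient of f~ is a unit or zero. A linear coefficient that is not a unit therefore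
    vanishes, and the derivatives of f~ then have constant term 0 rather than one merely divisible
    by pi. *)

Section IdealTheory.
Variable R : comPzRingType.
Implicit Types (I J K P Q : set R) (s : seq R).

Lemma ideal0 I : is_ideal I -> I 0. Proof. by case. Qed.
Lemma idealD I x y : is_ideal I -> I x -> I y -> I (x + y).
Proof. by case=> _ ID _; exact: ID. Qed.
Lemma idealMl I a x : is_ideal I -> I x -> I (a * x).
Proof. by case=> _ _ IM; exact: IM. Qed.
Lemma idealMr I a x : is_ideal I -> I x -> I (x * a).
Proof. by rewrite mulrC; exact: idealMl. Qed.
Lemma idealN I x : is_ideal I -> I x -> I (- x).
Proof. by move=> II Ix; rewrite -mulN1r; exact: idealMl. Qed.
Lemma idealB I x y : is_ideal I -> I x -> I y -> I (x - y).
Proof. by move=> II Ix Iy; apply: idealD => //; exact: idealN. Qed.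
Lemma ideal_sum I (T : Type) (r : seq T) (p : pred T) (F : T -> R) :
  is_ideal I -> (forall i, p i -> I (F i)) -> I (\sum_(i <- r | p i) F i).
Proof.
move=> II IF; apply: (big_ind I) => //; first exact: ideal0.
by move=> x y; exact: idealD.
Qed.

Lemma ideal_genS (S : set R) : S `<=` ideal_gen S.
Proof. by move=> x Sx I [_ SI]; exact: SI. Qed.

Lemma ideal_gen_sub (S I : set R) :
  is_ideal I -> S `<=` I -> ideal_set (ideal_gen S) `<=` I.
Proof. by move=> II SI x; apply; split. Qed.

Lemma ideal_gen_eqP (S I : set R) :
  is_ideal I -> S `<=` I -> I `<=` ideal_gen S -> I = ideal_gen S.
Proof. by move=> II SI IS; apply/seteqP; split=> //; exact: ideal_gen_sub. Qed.

Definition principal (x : R) : set R := [set z | exists a, z = a * x].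
Definition ideal_add I J : set R :=
  [set z | exists x y, [/\ I x, J y & z = x + y]].

Lemma principal_ideal x : is_ideal (principal x).
Proof.
split; first by exists 0; rewrite mul0r.
- by move=> _ _ [a ->] [b ->]; exists (a + b); rewrite mulrDl.
- by move=> b _ [a ->]; exists (b * a); rewrite mulrA.
Qed.

Lemma principal_refl x : principal x x. Proof. by exists 1; rewrite mul1r. Qed.

Lemma principal_sub I x : is_ideal I -> I x -> principal x `<=` I.
Proof. by move=> II Ix _ [a ->]; exact: idealMl. Qed.

Lemma ideal_gen1 x : ideal_set (ideal_gen [set x]) = principal x.
Proof.
apply/esym/ideal_gen_eqP; first exact: principal_ideal.
- by move=> _ ->; exact: principal_refl.
- by apply: principal_sub; [exact: idealP|exact: ideal_genS].
Qed.

Lemma ideal_add_ideal I J : is_ideal I -> is_ideal J -> is_ideal (ideal_add I J).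
Proof.
move=> II IJ; split; first by exists 0, 0; rewrite addr0; split=> //; exact: ideal0.
- move=> _ _ [a [b [Ia Jb ->]]] [c [d [Ic Jd ->]]].
  by exists (a + c), (b + d); rewrite addrACA; split=> //; exact: idealD.
- move=> r _ [a [b [Ia Jb ->]]].
  by exists (r * a), (r * b); rewrite mulrDr; split=> //; exact: idealMl.
Qed.

Lemma ideal_addl I J : is_ideal J -> I `<=` ideal_add I J.
Proof. by move=> IJ x Ix; exists x, 0; rewrite addr0; split=> //; exact: ideal0. Qed.
Lemma ideal_addr I J : is_ideal I -> J `<=` ideal_add I J.
Proof. by move=> II x Jx; exists 0, x; rewrite add0r; split=> //; exact: ideal0. Qed.

Lemma ideal_add_sub I J K : is_ideal K -> I `<=` K -> J `<=` K ->
  ideal_add I J `<=` K.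
Proof.
by move=> IK sI sJ _ [a [b [Ia Jb ->]]]; apply: idealD; [|apply: sI|apply: sJ].
Qed.

(** Finitely generated ideals in recursive form, suited to induction on the list of generators. *)
Fixpoint span s : set R :=
  if s is x :: s' then ideal_add (principal x) (span s') else [set 0].

Lemma span_ideal s : is_ideal (span s).
Proof.
elim: s => [|x s IH]; last exact/ideal_add_ideal/IH/principal_ideal.
split=> //; first by move=> _ _ -> ->; rewrite addr0.
by move=> a _ ->; rewrite mulr0.
Qed.

Lemma span_mem s x : x \in s -> span s x.
Proof.
elim: s => // y s IH; rewrite inE => /orP[/eqP->|/IH sx].
- apply: ideal_addl; [exact: span_ideal|exact: principal_refl].
- by apply: ideal_addr => //; exact: principal_ideal.
Qed.

Lemma span_sub s I : is_ideal I -> (forall x, x \in s -> I x) -> span s `<=` I.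
Proof.
move=> II; elim: s => [|x s IH] sI; first by move=> _ ->; exact: ideal0.
apply: ideal_add_sub => //.
  by apply: principal_sub => //; apply: sI; rewrite mem_head.
by apply: IH => y ys; apply: sI; rewrite inE ys orbT.
Qed.

Lemma spanP s y :
  span s y <-> exists a : nat -> R, y = \sum_(i < size s) a i * s`_i.
Proof.
split.
  elim: s y => [|z s IH] y /=; first by move=> ->; exists (fun=> 0); rewrite big_ord0.
  move=> [_ [w [[b ->] /IH[a ->] ->]]].
  by exists (fun i => if i is j.+1 then a j else b); rewrite big_ord_recl.
move=> [a ->]; apply: ideal_sum => [|i _]; first exact: span_ideal.
by apply: idealMl; [exact: span_ideal|apply/span_mem/mem_nth].
Qed.

Lemma ideal_gen_seq s : ideal_set (ideal_gen [set x | x \in s]) = span s.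
Proof.
apply/esym/ideal_gen_eqP; [exact: span_ideal|exact: span_mem|].
by apply: span_sub; [exact: idealP|move=> x xs; exact: ideal_genS].
Qed.

Lemma noetherianP : noetherian R <->
  forall I, is_ideal I -> exists s, I = span s.
Proof.
by split=> H I /H[s ->]; exists s; rewrite ideal_gen_seq.
Qed.

Lemma ideal_mul_ideal_sub I J K : is_ideal K ->
  (forall x y, I x -> J y -> K (x * y)) -> ideal_set (ideal_mul I J) `<=` K.
Proof.
move=> IK H; apply: ideal_gen_sub => // _ [x [y [Ix Jy ->]]]; exact: H.
Qed.

Lemma ideal_mulM I J x y : I x -> J y -> ideal_set (ideal_mul I J) (x * y).
Proof. by move=> Ix Jy; apply: ideal_genS; exists x, y. Qed.

Lemma ideal_pow_ideal I k : is_ideal (ideal_pow I k).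
Proof. by case: k => [|k]; [split|exact: idealP]. Qed.

Lemma ideal_pow1 I : is_ideal I -> ideal_pow I 1 = I.
Proof.
move=> II; apply/seteqP; split=> [|x Ix] /=.
  by apply: ideal_mul_ideal_sub => // x y Ix _; exact: idealMr.
by rewrite -(mulr1 x); exact: ideal_mulM.
Qed.

Lemma ideal_pow_anti I k : ideal_pow I k.+1 `<=` ideal_pow I k.
Proof.
apply: ideal_mul_ideal_sub; first exact: ideal_pow_ideal.
by move=> x y _; apply: idealMl; exact: ideal_pow_ideal.
Qed.

Lemma ideal_pow_exp I x k : I x -> ideal_pow I k (x ^+ k).
Proof. by move=> Ix; elim: k => [//|k IH]; rewrite exprS; exact: ideal_mulM. Qed.

Lemma prime_ideal P : is_prime P -> is_ideal P. Proof. by case. Qed.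
Lemma prime_exp P x k : is_prime P -> P (x ^+ k) -> P x.
Proof.
move=> pP; case: (pP) => _ P1 PM; elim: k => [/P1//|k IH].
by rewrite exprS => /PM[].
Qed.

Lemma proper_subsetP I J : I `<=` J -> I <> J -> I `<` J.
Proof. by move=> IJ nIJ; split=> // JI; apply: nIJ; apply/seteqP. Qed.

(** Without a maximal member, dependent choice yields a strictly increasing chain. Its union is
    finitely generated, so the term containing all the generators is already the whole union. *)
Lemma noetherian_max (C : set (set R)) : noetherian R ->
  (forall I, C I -> is_ideal I) -> C !=set0 ->
  exists2 I, C I & forall J, C J -> I `<=` J -> J = I.
Proof.
move=> /noetherianP nR CI [I0 CI0]; apply: contrapT => nmax.
have step (I : {I : set R | C I}) :
    exists J : {J : set R | C J}, sval I `<` sval J.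
  case: I => I CIi /=; apply: contrapT => nJ; apply: nmax; exists I => // J CJ IJ.
  apply: contrapT => neq; apply: nJ; exists (exist _ J CJ) => /=.
  by apply: proper_subsetP => // /esym.
have [g gP] := choice step.
pose c k := sval (iter k g (exist _ I0 CI0)).
have cI k : is_ideal (c k) by apply: CI; exact: svalP.
have cS k : c k `<` c k.+1 by exact: gP.
have mono k l : (k <= l)%N -> c k `<=` c l.
  elim: l => [|l IH]; first by rewrite leqn0 => /eqP->.
  by rewrite leq_eqVlt => /orP[/eqP->//|/IH] h; apply: (subset_trans h); case: (cS l).
have UI : is_ideal [set x | exists k, c k x].
  split; first by exists 0%N; exact: ideal0.
  - move=> x y [k kx] [l ly]; exists (maxn k l); apply: idealD => //.
      exact: mono (leq_maxl _ _) _ kx.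
    exact: mono (leq_maxr _ _) _ ly.
  - by move=> a x [k kx]; exists k; exact: idealMl.
have [s Us] := nR _ UI.
have [N sN] : exists N, forall x, x \in s -> c N x.
  have : forall x, x \in s -> exists k, c k x.
    by move=> x /span_mem; rewrite -Us.
  elim: s {Us} => [|x s IH] H; first by exists 0%N.
  have [k kx] := H x (mem_head _ _).
  have [|N HN] := IH; first by move=> y ys; apply: H; rewrite inE ys orbT.
  exists (maxn k N) => y; rewrite inE => /orP[/eqP->|/HN ys].
    exact: mono (leq_maxl _ _) _ kx.
  exact: mono (leq_maxr _ _) _ ys.
have [_] := cS N; apply=> x cx; apply: (span_sub (cI N) sN).
by rewrite -Us; exists N.+1.
Qed.

(** * Localization at a prime, expressed by saturated ideals *)

Section Saturation.
Variable P : set R.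
Hypothesis pP : is_prime P.

(** The contraction to R of the ideal that I generates in R_P. *)
Definition sat I : set R := [set a | exists2 s, ~ P s & I (s * a)].

Lemma nprime1 : ~ P 1. Proof. by case: pP. Qed.
Lemma nprimeM a b : ~ P a -> ~ P b -> ~ P (a * b).
Proof. by case: pP => _ _ PM na nb /PM[]. Qed.
Lemma nprimeB a b : ~ P a -> P b -> ~ P (a - b).
Proof.
move=> na Pb Pab; apply: na; rewrite -(subrK b a).
by apply: idealD => //; exact: prime_ideal.
Qed.

Lemma sat_ideal I : is_ideal I -> is_ideal (sat I).
Proof.
move=> II; split; first by exists 1; [exact: nprime1|rewrite mulr0; exact: ideal0].
- move=> x y [s ns sx] [t nt ty]; exists (s * t); first exact: nprimeM.
  rewrite mulrDr {1}(mulrC s) -!mulrA.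
  by apply: idealD => //; apply: idealMl.
- by move=> a x [s ns sx]; exists s => //; rewrite mulrCA; exact: idealMl.
Qed.

Lemma sub_sat I : I `<=` sat I.
Proof. by move=> x Ix; exists 1; [exact: nprime1|rewrite mul1r]. Qed.

Lemma satS I J : I `<=` J -> sat I `<=` sat J.
Proof. by move=> IJ x [s ns sx]; exists s => //; exact: IJ. Qed.

Lemma satK I (s a : R) : ~ P s -> sat I (s * a) -> sat I a.
Proof. by move=> ns [t nt ta]; exists (t * s); [exact: nprimeM|rewrite -mulrA]. Qed.

Lemma sat_sub I J : I `<=` sat J -> sat I `<=` sat J.
Proof. by move=> IJ a [s ns /IJ]; exact: satK. Qed.

(* [fin_len J]: the localization of R/J at P has finite length. *)
Inductive fin_len : set R -> Prop :=
| FinLen0 J : sat J 1 -> fin_len J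
| FinLenS J g : (forall p, P p -> sat J (p * g)) ->
    fin_len (ideal_add J (principal g)) -> fin_len J.

(** Noetherian induction: take I maximal among the ideals over J that violate the claim. An
    associated prime of I in R_P contains J and lies in P, hence is P; an element g killed by P
    modulo I then gives one more step of the filtration, to the larger ideal I + (g). *)
Lemma fin_len_minimal J : noetherian R -> is_ideal J ->
  (forall P', is_prime P' -> J `<=` P' -> P' `<=` P -> P' = P) -> fin_len J.
Proof.
move=> nR IJ minP; apply: contrapT => nfl.
pose C : set (set R) := [set I | [/\ is_ideal I, J `<=` I & ~ fin_len I]].
have [I [II JI nI] Imax] : exists2 I, C I & forall K, C K -> I `<=` K -> K = I.
  by apply: noetherian_max => // [I []//|]; exists J; split.
have nI1 : ~ sat I 1 by move=> ?; apply: nI; exact: FinLen0.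
pose ann g : set R := [set a | sat I (a * g)].
have annI g : is_ideal (ann g).
  have IS := sat_ideal II; split; rewrite /ann /= ?mul0r; first exact: ideal0.
  - by move=> x y xg yg; rewrite mulrDl; exact: idealD.
  - by move=> a x xg; rewrite -mulrA; exact: idealMl.
(* A maximal annihilator is prime: if [a * b] kills g and a does not, the annihilator of [a * g]
   contains b and, by maximality, equals that of g. *)
pose D : set (set R) := [set K | exists2 g, ~ sat I g & K = ann g].
have [K [g ng ->{K}] gmax] : exists2 K, D K & forall L, D L -> K `<=` L -> L = K.
  apply: noetherian_max => // [_ [g _ ->]//|].
  by exists (ann 1), 1.
have pann : is_prime (ann g).
  split=> //; first by rewrite /ann /= mul1r.
  move=> a b; rewrite {1}/ann /= => abg.
  case: (pselect (ann g a)) => [|na]; [by left|right].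
  rewrite -(gmax (ann (a * g))); first by rewrite /ann /= mulrA (mulrC b).
    by exists (a * g).
  move=> c; rewrite /ann /= mulrCA => cg.
  by apply: idealMl => //; exact: sat_ideal.
have annP : ann g = P.
  apply: minP => //.
  - move=> x /JI Ix; apply: idealMr; [exact: sat_ideal|exact: sub_sat].
  - move=> r rg; apply: contrapT => nr; apply: ng; exact: satK rg.
apply: nI; apply: (@FinLenS I g); first by rewrite -annP.
apply: contrapT => nfl'.
have Ig := ideal_add_ideal II (principal_ideal g).
have eqI := Imax (ideal_add I (principal g)); apply: ng; apply: sub_sat.
rewrite -eqI; first by apply: ideal_addr => //; exact: principal_refl.
  split=> // x /JI Ix; apply: ideal_addl => //; exact: principal_ideal.
by apply: ideal_addl; exact: principal_ideal.
Qed.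

(** Induction along the filtration: the chain stabilizes modulo g, and what remains is the multiples
    of g, which form at most a line over the residue field of P. Only the membership of g in the
    terms of the chain is then left to control. *)
Lemma fin_len_dcc J (I : nat -> set R) : fin_len J ->
  (forall k, is_ideal (I k)) -> (forall k, J `<=` I k) ->
  (forall k l, (k <= l)%N -> I l `<=` I k) ->
  exists N, forall k, (N <= k)%N -> I N `<=` sat (I k).
Proof.
move=> fl; elim: fl I => {J} [J J1|J g Jg _ IH] I II JI mono.
  exists 0%N => k _ a _; have [s ns] := satS (JI k) J1.
  by rewrite mulr1 => Is; exists s => //; exact: idealMr.
have [|||K1 HK1] := IH (fun k => ideal_add (I k) (principal g)).
- by move=> k; exact/ideal_add_ideal/principal_ideal.
- move=> k; apply: ideal_add_sub.
  + exact/ideal_add_ideal/principal_ideal.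
  + by apply: (subset_trans (JI k)); apply: ideal_addl; exact: principal_ideal.
  + exact: ideal_addr.
- move=> k l /mono kl _ [x [y [/kl Ix gy ->]]]; by exists x, y.
(* As the chain decreases, g leaves the saturations at most once; past that index the implication is
   vacuous. *)
have [K2 HK2] : exists N, forall k, (N <= k)%N -> sat (I N) g -> sat (I k) g.
  case: (pselect (forall k, sat (I k) g)) => [all|/existsNP[K nK]].
    by exists 0%N.
  by exists K => k _ /nK.
exists (maxn K1 K2) => k; rewrite geq_max => /andP[k1 k2] a Ia.
have Ia1 : I K1 a by apply: mono Ia; exact: leq_maxl.
have [] := HK1 k k1 a; first exact: (ideal_addl (principal_ideal g)).
move=> s ns [b [_ [Ib [r ->] sa]]].
have rgE : r * g = s * a - b by rewrite sa addrC addKr.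
apply: (satK ns); rewrite sa; apply: idealD; [exact: sat_ideal|exact: sub_sat|].
have IS := sat_ideal (II k).
(* If r is in P, then [r * g] is in the saturation of J; otherwise r is invertible at P and g itself
   is in the saturation of [I K2]. *)
case: (pselect (P r)) => [/Jg|nr]; first exact: (satS (JI k)).
apply: idealMl => //; apply: HK2 => //; apply: (satK nr); apply: sub_sat.
apply: (mono _ _ (leq_maxr K1 K2)); rewrite rgE; apply: idealB => //.
  exact: idealMl.
by apply: mono Ib; rewrite geq_max k1.
Qed.

(** Modulo the first generator a the induction hypothesis applies and places the whole span in N +
    (a), locally at P. Substituting this back turns the assumption on a into a relation that puts a
    multiple of a by an element outside P into N. *)
Lemma nakayama s N : is_ideal N ->
  span s `<=` sat (ideal_add N (ideal_mul P (span s))) -> span s `<=` sat N.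
Proof.
elim: s N => [|a s IH] N IN H.
  by move=> _ ->; apply: ideal0; exact: sat_ideal.
have IPm := prime_ideal pP; have Is := span_ideal s.
have IM := idealP (ideal_mul P (span s)).
have mulS z : ideal_set (ideal_mul P (span (a :: s))) z ->
    exists r z', [/\ P r, ideal_set (ideal_mul P (span s)) z' & z = r * a + z'].
  apply: (@ideal_gen_sub _ [set z | exists r z', [/\ P r,
      ideal_set (ideal_mul P (span s)) z' & z = r * a + z']]).
    split.
    - by exists 0, 0; rewrite mul0r addr0; split=> //; exact: ideal0.
    - move=> _ _ [r [z' [Pr z'P ->]]] [t [y' [Pt y'P ->]]].
      exists (r + t), (z' + y'); rewrite mulrDl addrACA.
      split=> //; [exact: (idealD IPm)|exact: (idealD IM)].
    - move=> b _ [r [z' [Pr z'P ->]]].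
      exists (b * r), (b * z'); rewrite mulrDr mulrA.
      split=> //; [exact: (idealMl _ IPm)|exact: (idealMl _ IM)].
  move=> _ [p [_ [Pp [_ [w [[b ->] sw ->]]] ->]]].
  exists (p * b), (p * w); split; first exact: idealMr.
    exact: ideal_mulM.
  by rewrite mulrDr mulrA.
have Na_ideal := ideal_add_ideal IN (principal_ideal a).
have sub s' : span s' `<=` sat (ideal_add N (principal a)) ->
    span (a :: s') `<=` sat (ideal_add N (principal a)).
  move=> h; apply: ideal_add_sub => //; first exact: sat_ideal.
  by by apply: subset_trans (@sub_sat _); exact: ideal_addr.
have sNa : span (a :: s) `<=` sat (ideal_add N (principal a)).
  apply: sub; apply: (IH _ Na_ideal) => y sy.
  have [|t nt [u [v [Nu /mulS[r [v' [Pr Pv' ->]]] tE]]]] := H y.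
    by apply: ideal_addr => //; exact: principal_ideal.
  exists t => //; rewrite tE addrA; exists (u + r * a), v'; split=> //.
  by exists u, (r * a); split=> //; exists r.
have aN : sat N a.
  have [|t nt [u [v [Nu /mulS[r [v' [Pr Pv' ->]]] tE]]]] := H a.
    by apply: ideal_addl => //; exact: principal_refl.
  (* By [sNa], an element of [P * span s] becomes an element of N + P a once multiplied by some
     factor outside P. *)
  have [t' nt' [r' [Pr' Nv']]] : exists2 t', ~ P t' &
      exists r', P r' /\ N (t' * v' - r' * a).
    move: v' Pv' {tE}; apply: (@ideal_gen_sub _ [set v' | exists2 t', ~ P t' &
      exists r', P r' /\ N (t' * v' - r' * a)]).
      split.
      - exists 1; first exact: nprime1.
        by exists 0; rewrite mulr0 mul0r subr0; split; exact: ideal0.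
      - move=> x y [p np [p' [Pp' Np]]] [q nq [q' [Pq' Nq]]].
        exists (p * q); first exact: nprimeM.
        exists (q * p' + p * q'); split; first by apply: (idealD IPm); exact: idealMl.
        have -> : p * q * (x + y) - (q * p' + p * q') * a =
            q * (p * x - p' * a) + p * (q * y - q' * a).
          by rewrite !mulrBr !mulrDr mulrDl opprD addrACA !mulrA (mulrC q p).
        by apply: idealD => //; exact: idealMl.
      - move=> b x [p np [p' [Pp' Np]]]; exists p => //; exists (b * p').
        split; first exact: idealMl.
        have -> : p * (b * x) - b * p' * a = b * (p * x - p' * a).
          by ring.
        exact: idealMl.
    move=> _ [p [w [Pp sw ->]]].
    have [|t0 nt0 [n0 [_ [Nn0 [c ->] e]]]] := sNa w.
      by apply: ideal_addr => //; exact: principal_ideal.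
    exists t0 => //; exists (p * c); split; first exact: idealMr.
    have -> : t0 * (p * w) - p * c * a = p * n0.
      by rewrite mulrCA e mulrDr mulrA addrK.
    exact: idealMl.
  (* This is outside P, because [t' * t] is and both r and r' lie in P. *)
  exists (t' * t - (t' * r + r')).
    by apply: nprimeB; [exact: nprimeM|apply: idealD => //; exact: idealMl].
  have -> : (t' * t - (t' * r + r')) * a = t' * u + (t' * v' - r' * a).
    rewrite mulrBl -mulrA tE !mulrDr mulrDl !mulrA.
    by rewrite opprD [t' * r * a + _]addrC !addrA addrK.
  by apply: idealD => //; exact: idealMl.
apply: (subset_trans sNa); apply: sat_sub; apply: ideal_add_sub => //.
- exact: sat_ideal.
- exact: sub_sat.
- by apply: principal_sub => //; exact: sat_ideal.
Qed.
End Saturation.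
End IdealTheory.

(** * Krull's principal ideal theorem *)

Section KrullHeight.
Variable R : comPzRingType.
Implicit Types (I J P Q : set R) (c : nat -> set R).

(** Krull's theorem in the domain R/Q0, contraposed. Without such a P', the prime P would be minimal
    over Q0 + (x), and the symbolic powers of Q modulo Q0 would become stationary, which forces Q =
    Q0. *)
Lemma principal_ideal_theorem Q0 Q P x : noetherian R ->
  is_prime Q0 -> is_prime Q -> is_prime P -> Q0 `<` Q -> Q `<` P -> P x ->
  exists P', [/\ is_prime P', Q0 `<=` P', P' x & P' `<` P].
Proof.
move=> nR pQ0 pQ pP [Q0Q nQ0Q] [QP nQP] Px; apply: contrapT => nP'.
have [[IQ0 IQ] IP] := (prime_ideal pQ0, prime_ideal pQ, prime_ideal pP).
have nQx : ~ Q x by move=> Qx; apply: nP'; exists Q; split.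
have npP y : ~ P y -> ~ Q y by move=> ny /QP.
have flJ : fin_len P (ideal_add Q0 (principal x)).
  apply: fin_len_minimal => //; first exact/ideal_add_ideal/principal_ideal.
  move=> P' pP' JP' P'P; apply/seteqP; split=> //.
  apply: contrapT => nPP'; apply: nP'; exists P'; split=> //.
    by move=> y Qy; apply: JP'; apply: ideal_addl => //; exact: principal_ideal.
  by apply: JP'; apply: ideal_addr => //; exact: principal_refl.
pose S k := sat Q (ideal_add Q0 (ideal_pow Q k)).
have IQk k : is_ideal (ideal_add Q0 (ideal_pow Q k)).
  exact/ideal_add_ideal/ideal_pow_ideal.
have IS k : is_ideal (S k) by exact: sat_ideal.
have SS k : S k.+1 `<=` S k.
  apply: satS => _ [a [b [Qa Qb ->]]]; exists a, b; split=> //.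
  exact: ideal_pow_anti.
have Smono k l : (k <= l)%N -> S l `<=` S k.
  elim: l => [|l IH]; first by rewrite leqn0 => /eqP->.
  rewrite leq_eqVlt => /orP[/eqP->//|/IH h]; exact: subset_trans (SS l) h.
have Q0S k : Q0 `<=` S k.
  by move=> a Qa; apply: (sub_sat pQ); apply: (ideal_addl (ideal_pow_ideal _ _)).
have Px_ideal := principal_ideal x.
have [|||K HK] := @fin_len_dcc R P pP _ (fun k => ideal_add (S k) (principal x)) flJ.
- by move=> k; exact: ideal_add_ideal.
- move=> k; apply: ideal_add_sub; first exact: ideal_add_ideal.
    by apply: (subset_trans (Q0S k)); exact: ideal_addl.
  exact: ideal_addr.
- by move=> k l /Smono kl _ [a [b [/kl Sa pb ->]]]; exists a, b.
have /noetherianP nR' := nR.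
(* The descending chain of symbolic powers [S k] stabilizes, first modulo x by
   finite length, then on the nose by Nakayama. *)
have SK : S K `<=` S K.+1.
  have [s sE] := nR' _ (IS K).
  have : S K `<=` sat P (S K.+1).
    rewrite sE; apply: (nakayama pP (IS _)) => a; rewrite -sE => Sa.
    have [t nt [b [_ [Sb [r ->] tE]]]] :=
      HK _ (leqnSn K) a (ideal_addl Px_ideal Sa).
    exists t => //; exists b, (x * r); rewrite tE (mulrC x); split=> //.
    (* Since [x * r = t * a - b] lies in [S K] and x is outside Q, r lies in [S K]. Thus [S K] is
       contained in S(K+1) + P S(K) locally at P. *)
    rewrite mulrC; apply: ideal_mulM => //; apply: (satK pQ nQx).
    have -> : x * r = t * a - b by rewrite tE; ring.
    apply: (idealB (IS K)); first exact: (idealMl _ (IS K)).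
    exact: SS.
  by move=> h a /h[t /npP nt]; apply: (satK pQ nt).
have [s sE] := nR' _ (ideal_pow_ideal Q K).
(* A second use of Nakayama, now at Q: modulo Q0 the powers K and K+1 of Q agree locally, so that
   Q^K vanishes there. *)
have QK : ideal_pow Q K `<=` sat Q Q0.
  rewrite sE; apply: (nakayama pQ IQ0); rewrite -sE.
  have -> : ideal_set (ideal_mul Q (ideal_pow Q K)) = ideal_pow Q K.+1 by [].
  by move=> a Qa; apply/SK/(sub_sat pQ)/(ideal_addr IQ0).
apply: nQ0Q => y /(@ideal_pow_exp _ Q y K)/QK[t nt].
case: (pQ0) => _ _ h /h[/Q0Q//|]; exact: (prime_exp pQ0).
Qed.

Lemma subset_chain k c : prime_chain k c ->
  forall i j, (i <= j)%N -> (j <= k)%N -> c i `<=` c j.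
Proof.
move=> [_ cS] i; elim=> [|j IH]; first by rewrite leqn0 => /eqP-> _.
rewrite leq_eqVlt => /orP[/eqP-> _ //|ij jk].
by apply: (subset_trans (IH ij (ltnW jk))); case: (cS j jk).
Qed.

(* The principal ideal theorem, applied from the top of the chain downwards,
   moves [x] into smaller and smaller members of the chain. *)
Lemma prime_chain_exchange h c x : noetherian R -> prime_chain h.+1 c ->
  c h.+1 x -> exists c', [/\ prime_chain h.+1 c', c' 0%N = c 0%N,
                            c' h.+1 = c h.+1 & c' 1%N x].
Proof.
move=> nR; elim: h c => [|h IH] c [pc cS] cx; first by exists c; split.
(* The prime just below the top can be made to contain x: it is kept if it already does, and
   otherwise replaced by P', which differs from [c h] because x is not in [c h]. *)
have [Q [pQ cQ Qc Qx]] : exists Q, [/\ is_prime Q, c h `<` Q, Q `<` c h.+2 & Q x].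
  have [P' [pP' hP' P'x P'h]] : exists P',
      [/\ is_prime P', c h `<=` P', P' x & P' `<` c h.+2].
    by apply: (@principal_ideal_theorem (c h) (c h.+1)) => //;
      solve [apply: pc; lia | apply: cS; lia].
  case: (pselect (c h.+1 x)) => [cx1|ncx1].
    by exists (c h.+1); split=> //; [apply: pc|apply: cS|apply: cS].
  exists P'; split=> //; split=> // P'c.
  apply: ncx1; have [+ _] := cS h (ltnW (ltnSn _)); apply; exact: P'c.
pose d i := if (i <= h)%N then c i else Q.
have [||c' [[pc' cS'] c'0 c'h c'x]] := IH d.
- split=> i ih; rewrite /d.
    by case: ifP => // _; apply: pc; lia.
  rewrite -ltnS ih; case: ifP => [ih'|]; first by apply: cS; lia.
  by move=> /negbT; rewrite -ltnNge ltnS => hi; have -> : i = h by lia.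
- by rewrite /d ltnn.
exists (fun i => if (i <= h.+1)%N then c' i else c h.+2); split=> //=.
- split=> i ih; first by case: ifP => // ih'; [exact: pc'|apply: pc].
  rewrite -ltnS ih; case: ifP => [ih'|]; first exact: cS'.
  move=> /negbT; rewrite -ltnNge ltnS => hi; have -> : i = h.+1 by lia.
  by rewrite c'h /d ltnn.
- by rewrite ltnn.
Qed.

Lemma prime_chain_behead h c : prime_chain h.+1 c -> prime_chain h (fun i => c i.+1).
Proof. by move=> [pc cS]; split=> i ih; [exact: pc|exact: cS]. Qed.

(** Krull's height theorem, relative to the bottom of the chain. Exchanging x into the second prime
    and dropping the first shortens the chain by one, and its top is minimal over the new bottom
    together with the remaining generators. *)
Lemma prime_chain_bound h c s : noetherian R -> prime_chain h c ->
  (forall P, is_prime P -> c 0%N `<=` P -> (forall x, x \in s -> P x) ->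
     P `<=` c h -> P = c h) ->
  (forall x, x \in s -> c h x) ->
  (h <= size s)%N.
Proof.
move=> nR; elim: s h c => [|x s IH] [|h] c cc minP sc //.
  have [pc cS] := cc; have [_] := cS 0%N isT; case.
  have -> : c 0%N = c h.+1.
    by apply: minP => //; [exact: pc|exact: (subset_chain cc)].
  exact: (subset_chain cc).
have cx : c h.+1 x by apply: sc; exact: mem_head.
have [c' [cc' c'0 c'h c'x]] := prime_chain_exchange nR cc cx.
rewrite /= ltnS; apply: (IH h (fun i => c' i.+1)); first exact: prime_chain_behead.
  move=> P pP c'P sP; rewrite c'h => Ph; apply: minP => //.
    apply: subset_trans c'P; rewrite -c'0; exact: (subset_chain cc').
  by move=> y; rewrite inE => /orP[/eqP->|/sP//]; exact: c'P.
move=> y ys; rewrite c'h; apply: sc; by rewrite inE ys orbT.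
Qed.
End KrullHeight.

(** * Local rings and quotients *)

Section RingMaps.
Variables (A B : comPzRingType) (phi : {rmorphism A -> B}).

Lemma preimage_ideal I : is_ideal I -> is_ideal (phi @^-1` I).
Proof.
move=> II; split; rewrite /preimage /=.
- by rewrite rmorph0; exact: ideal0.
- by move=> x y Ix Iy; rewrite rmorphD; exact: idealD.
- by move=> a x Ix; rewrite rmorphM; exact: idealMl.
Qed.

Lemma preimage_prime P : is_prime P -> is_prime (phi @^-1` P).
Proof.
move=> [IP P1 PM]; split; first exact: preimage_ideal.
- by rewrite /preimage /= rmorph1.
- by move=> x y; rewrite /preimage /= rmorphM; exact: PM.
Qed.

Hypothesis phi_surj : forall b, exists a, phi a = b.

Lemma image_ideal I : is_ideal I -> is_ideal (phi @` I).
Proof.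
move=> II; split; first by exists 0; rewrite ?rmorph0 //; exact: ideal0.
- move=> _ _ [a Ia <-] [b Ib <-].
  by exists (a + b); rewrite ?rmorphD //; exact: idealD.
- move=> b _ [a Ia <-]; have [c <-] := phi_surj b.
  by exists (c * a); rewrite ?rmorphM //; exact: idealMl.
Qed.

Lemma image_ideal_gen S : phi @` ideal_gen S = ideal_gen (phi @` S).
Proof.
apply: ideal_gen_eqP.
- exact/image_ideal/idealP.
- by move=> _ [x Sx <-]; exists x => //; exact: ideal_genS.
- move=> _ [x Sx <-].
  apply: (@ideal_gen_sub _ _ (phi @^-1` ideal_gen (phi @` S))) Sx.
    exact/preimage_ideal/idealP.
  by move=> y Sy; apply: ideal_genS; exists y.
Qed.

Lemma noetherian_surj : noetherian A -> noetherian B.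
Proof.
move=> /noetherianP nA; apply/noetherianP => I II.
have [s sE] := nA _ (preimage_ideal II).
exists (map phi s); rewrite -ideal_gen_seq.
have -> : [set x | x \in map phi s] = phi @` [set x | x \in s].
  apply/seteqP; split=> [_ /mapP[x xs ->]|_ [x xs <-]]; first by exists x.
  exact: map_f.
rewrite -image_ideal_gen ideal_gen_seq -sE; apply/seteqP; split.
  by move=> b; have [a <-] := phi_surj b; exists a.
by move=> _ [a Ia <-].
Qed.

End RingMaps.

Section LocalRings.
Variable R : comPzRingType.
Implicit Types M : set R.

Lemma proper_ideal (I : set R) : is_ideal I -> I <> setT -> ~ I 1.
Proof.
move=> II nI I1; apply: nI; apply/seteqP; split=> // x _.
by rewrite -(mulr1 x); exact: idealMl.
Qed.

Lemma is_localP M : is_ideal M -> ~ M 1 ->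
  (forall x, ~ M x -> exists y, x * y = 1) -> is_local M.
Proof.
move=> IM M1 Minv.
have sub J : is_ideal J -> J <> setT -> J `<=` M.
  move=> IJ /(proper_ideal IJ) J1 x Jx; apply: contrapT => /Minv[y xy].
  by apply: J1; rewrite -xy; exact: idealMr.
split; first split=> //.
- by move=> MT; apply: M1; rewrite MT.
- move=> J IJ MJ; case: (pselect (J = setT)) => [|nJ]; [by right|left].
  by apply/seteqP; split=> //; exact: sub.
- move=> M' [IM' nM' maxM']; have [-> //|MT] := maxM' _ IM (sub _ IM' nM').
  by case: M1; rewrite MT.
Qed.

Lemma local_unique M M' : is_local M -> is_local M' -> M' = M.
Proof. by move=> [_ +] [mM' _]; apply. Qed.

(** The maximal condition plays the role of Zorn's lemma: for a non-invertible x, a maximal member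
    among the proper ideals containing x is a maximal ideal, hence M. *)
Lemma local_inv M x : noetherian R -> is_local M -> ~ M x -> exists y, x * y = 1.
Proof.
move=> nR [_ uM] nMx; apply: contrapT => nx.
pose C : set (set R) := [set I | [/\ is_ideal I, ~ I 1 & I x]].
have [I [II I1 Ix] Imax] : exists2 I, C I & forall J, C J -> I `<=` J -> J = I.
  apply: noetherian_max => // [I []//|]; exists (principal x); split.
  - exact: principal_ideal.
  - by move=> [y e]; apply: nx; exists y; rewrite mulrC.
  - exact: principal_refl.
apply: nMx; rewrite -(uM I) //; split=> //.
  by move=> IT; apply: I1; rewrite IT.
move=> J IJ IJ'; case: (pselect (J = setT)) => [|/(proper_ideal IJ) J1]; first by right.
by left; apply: Imax => //; split=> //; exact: IJ'.
Qed.
End LocalRings.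

Section Quotients.
Variables (R : comPzRingType) (I : ideal R).
Local Notation p := (quo_proj I).

Fact quo_proj_is_additive : zmod_morphism p.
Proof.
move=> x y; rewrite quo_projD; congr (_ + _).
have p0 : p 0 = 0 by apply: (addrI (p 0)); rewrite -quo_projD !addr0.
by apply: (addrI (p y)); rewrite -quo_projD !subrr p0.
Qed.
HB.instance Definition _ := GRing.isZmodMorphism.Build R (quo I) p quo_proj_is_additive.

Fact quo_proj_is_multiplicative : monoid_morphism p.
Proof. by split=> // x y; exact: quo_projM. Qed.
HB.instance Definition _ :=
  GRing.isMonoidMorphism.Build R (quo I) p quo_proj_is_multiplicative.

Lemma quo_proj_surj u : exists x, p x = u.
Proof. by exists (repr u); exact: quo_projK. Qed.

Lemma quo_proj0P x : p x = 0 <-> ideal_set I x.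
Proof. by rewrite -(rmorph0 p) quo_eqP subr0. Qed.

Lemma quo_imageP J x : is_ideal J -> ideal_set I `<=` J -> (p @` J) (p x) <-> J x.
Proof.
move=> IJ sIJ; split=> [[y Jy /esym/quo_eqP/sIJ Jxy]|Jx]; last by exists x.
by rewrite -(subrK y x); exact: idealD.
Qed.

Lemma quo_image_prime P : is_prime P -> ideal_set I `<=` P -> is_prime (p @` P).
Proof.
move=> pP sIP; have [IP P1 PM] := pP; split.
- by apply: image_ideal => //; exact: quo_proj_surj.
- by rewrite -(rmorph1 p) quo_imageP.
- move=> u v; have [x <-] := quo_proj_surj u; have [y <-] := quo_proj_surj v.
  by rewrite -rmorphM !quo_imageP //; exact: PM.
Qed.

Lemma quo_image_subset P Q : is_ideal P -> is_ideal Q ->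
  ideal_set I `<=` P -> P `<` Q ->
  p @` P `<` p @` Q.
Proof.
move=> IP IQ sIP [PQ nQP]; split; first exact: image_subset.
move=> QP; apply: nQP => x Qx; have /QP : (p @` Q) (p x) by exists x.
by rewrite quo_imageP.
Qed.

Lemma quo_preimage_subset (P Q : set (quo I)) : P `<` Q -> p @^-1` P `<` p @^-1` Q.
Proof.
move=> [PQ nQP]; split; first by move=> x; exact: PQ.
by move=> QP; apply: nQP => u; have [x <-] := quo_proj_surj u; exact: QP.
Qed.

Lemma quo_preimage_chain k (c : nat -> set (quo I)) : prime_chain k c ->
  prime_chain k (fun i => p @^-1` c i) /\
  forall i, (i <= k)%N -> ideal_set I `<=` p @^-1` c i.
Proof.
move=> [pc cS]; split.
  by split=> i ik; [exact/preimage_prime/pc|exact/quo_preimage_subset/cS].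
move=> i ik x /quo_proj0P Ix; rewrite /preimage /= Ix.
exact: (ideal0 (prime_ideal (pc _ ik))).
Qed.

Lemma quo_image_chain k (c : nat -> set R) :
  prime_chain k c -> ideal_set I `<=` c 0%N ->
  prime_chain k (fun i => p @` c i).
Proof.
move=> cc I0; have [pc cS] := cc.
have Ic i : (i <= k)%N -> ideal_set I `<=` c i.
  by move=> ik; apply: (subset_trans I0); exact: (subset_chain cc).
split=> i ik; first by apply: quo_image_prime; [exact: pc|exact: Ic].
apply: quo_image_subset; [| |exact/Ic/ltnW|exact: cS].
  exact/prime_ideal/pc/ltnW.
exact/prime_ideal/pc.
Qed.

Lemma quo_noetherian : noetherian R -> noetherian (quo I).
Proof. exact/noetherian_surj/quo_proj_surj. Qed.

Lemma quo_local M : is_ideal M -> ~ M 1 ->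
  (forall x, ~ M x -> exists y, x * y = 1) ->
  ideal_set I `<=` M -> is_local (p @` M).
Proof.
move=> IM M1 Minv IsM; apply: is_localP.
- by apply: image_ideal => //; exact: quo_proj_surj.
- by rewrite -(rmorph1 p) quo_imageP.
- move=> u; have [x <-] := quo_proj_surj u; rewrite quo_imageP // => /Minv[y xy].
  by exists (p y); rewrite -rmorphM xy rmorph1.
Qed.
End Quotients.

(** * Hilbert's basis theorem for power series *)

(* B is a ring of power series A[[x]], presented by the constants [iota], the
   constant term [aug], and the operator [D] dividing the rest by [x]. *)
Section PowerSeriesNoetherian.
Variables (A B : comPzRingType).
Variables (iota : {rmorphism A -> B}) (aug : {rmorphism B -> A}).
Variables (x : B) (D : B -> B).
Hypothesis aug_iota : forall a, aug (iota a) = a.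
Hypothesis aug_D : forall b, b = iota (aug b) + x * D b.
Hypothesis x_sep : forall b, (forall k, principal (x ^+ k) b) -> b = 0.
Hypothesis x_complete : forall a : nat -> A, exists q, forall k,
  principal (x ^+ k) (q - \sum_(i < k) iota (a i) * x ^+ i).
Hypothesis noethA : noetherian A.
Implicit Types I J : set B.

Lemma aug_surj a : exists b, aug b = a.
Proof. by exists (iota a). Qed.

(** The t_i lift generators of the ideal [aug J] of A. Subtracting a combination with constant
    coefficients kills the constant term of g, and the rest is divisible by x. *)
Lemma lift_generators J : is_ideal J -> exists t : seq B,
  (forall i, (i < size t)%N -> J t`_i) /\
  (forall g, J g -> exists (a : nat -> A) b,
     g = \sum_(i < size t) iota (a i) * t`_i + x * b).
Proof.
move=> IJ; have /noetherianP nA := noethA.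
have [s sE] := nA _ (image_ideal aug_surj IJ).
have /choice[f fP] y : exists b, y \in s -> J b /\ aug b = y.
  case: (pselect (y \in s)) => [ys|nys]; last by exists 0.
  by have := span_mem ys; rewrite -sE => -[b Jb <-]; exists b.
exists (map f s); rewrite size_map; split=> [i si|g Jg].
  by rewrite (nth_map 0) //; have [] := fP _ (mem_nth 0 si).
have /spanP[a ga] : span s (aug g) by rewrite -sE; exists g.
exists a, (D (g - \sum_(i < size s) iota (a i) * (map f s)`_i)).
apply/eqP; rewrite addrC -subr_eq; apply/eqP; rewrite {1}[LHS]aug_D.
rewrite rmorphB rmorph_sum ga /= -sumrB big1 ?rmorph0 ?add0r // => i _.
by rewrite rmorphM aug_iota (nth_map 0) // (fP _ (mem_nth 0 _)).2 // subrr.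
Qed.

(** Each remainder b is again in J, so the division can be iterated. The successive constants
    attached to t_i are the coefficients of a series in x, which exists by completeness. *)
Lemma fg_saturated J : is_ideal J -> (forall b, J (x * b) -> J b) ->
  exists s, J = span s.
Proof.
move=> IJ satJ; have [t [Jt tP]] := lift_generators IJ; exists t.
apply/seteqP; split; last first.
  by apply: span_sub => // _ /(nthP 0)[i /Jt ? <-].
have step (g : {g : B | J g}) : exists r : (nat -> A) * {g : B | J g},
    sval g = \sum_(i < size t) iota (r.1 i) * t`_i + x * sval r.2.
  case: g => g Jg /=; have [a [b gE]] := tP g Jg.
  suff Jb : J b by exists (a, exist _ b Jb).
  apply: satJ; have -> : x * b = g - \sum_(i < size t) iota (a i) * t`_i.
    by rewrite gE addrC addKr.
  apply: idealB => //; apply: ideal_sum => // i _; apply: idealMl => //; exact: Jt.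
have [F FP] := choice step.
move=> g Jg; pose G k := iter k (fun h => (F h).2) (exist _ g Jg).
have GE k : g = \sum_(i < size t) (\sum_(j < k) iota ((F (G j)).1 i) * x ^+ j) * t`_i
                + x ^+ k * sval (G k).
  elim: k => [|k IH].
    by rewrite big1 ?add0r ?mul1r // => i _; rewrite big_ord0 mul0r.
  rewrite [LHS]IH (FP (G k)) mulrDr mulrA -exprSr addrA /=; congr (_ + _).
  rewrite mulr_sumr -big_split; apply: eq_bigr => i _.
  by rewrite big_ord_recr /=; ring.
have [q qP] := choice (fun i => x_complete (fun k => (F (G k)).1 i)).
apply/spanP; exists q; apply/eqP; rewrite -subr_eq0; apply/eqP/x_sep => k.
have Ik := principal_ideal (x ^+ k).
rewrite {1}(GE k) addrAC -sumrB; apply: (idealD Ik); last first.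
  by exists (sval (G k)); rewrite mulrC.
apply: (ideal_sum _ Ik) => i _; rewrite -mulrBl -opprB mulNr -mulrN.
exact: (idealMr _ Ik).
Qed.

(** A single division leaves a remainder [x * b] in J, that is, b in the colon ideal (J : x); so J
    is generated by t and the multiples x s. *)
Lemma fg_colon J : is_ideal J -> (exists s, [set b | J (x * b)] = span s) ->
  exists s, J = span s.
Proof.
move=> IJ [s sE]; have [t [Jt tP]] := lift_generators IJ.
have Js b : b \in s -> J (x * b) by move=> /span_mem; rewrite -sE.
have Ispan := span_ideal (t ++ map ( *%R x) s).
exists (t ++ map ( *%R x) s); apply/seteqP; split; last first.
  apply: span_sub => // y; rewrite mem_cat => /orP[/(nthP 0)[i /Jt ? <- //]|].
  by move=> /mapP[b /Js ? ->].
move=> g Jg; have [a [b gE]] := tP g Jg; rewrite gE.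
have Jsum : J (\sum_(i < size t) iota (a i) * t`_i).
  by apply: ideal_sum => // i _; apply: idealMl => //; exact: Jt.
apply: (idealD Ispan).
  apply: (ideal_sum _ Ispan) => i _; apply: (idealMl _ Ispan); apply: span_mem.
  by rewrite mem_cat mem_nth.
have /spanP[c ->] : span s b.
  rewrite -sE /=; have -> : x * b = g - \sum_(i < size t) iota (a i) * t`_i.
    by rewrite gE addrC addKr.
  exact: idealB.
rewrite mulr_sumr; apply: (ideal_sum _ Ispan) => i _; rewrite mulrCA.
apply: (idealMl _ Ispan); apply: span_mem; rewrite mem_cat map_f ?orbT //.
exact: mem_nth.
Qed.

(** The saturation U of I by powers of x is finitely generated, so U = (I : x^N) for some N. From
    there N applications of [fg_colon] lead back to I. *)
Lemma noetherian_power_series : noetherian B.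
Proof.
apply/noetherianP => I II.
have colonI k : is_ideal [set b | I (x ^+ k * b)].
  split=> /=; first by rewrite mulr0; exact: ideal0.
  - by move=> a b Ia Ib; rewrite mulrDr; exact: idealD.
  - by move=> a b Ib; rewrite mulrCA; exact: idealMl.
have colonS k l b : (k <= l)%N -> I (x ^+ k * b) -> I (x ^+ l * b).
  by move=> /subnK <-; rewrite exprD -mulrA; exact: idealMl.
pose U := [set b | exists k, I (x ^+ k * b)].
have IU : is_ideal U.
  split; first by exists 0%N; rewrite mulr0; exact: ideal0.
  - move=> a b [k Ia] [l Ib]; exists (maxn k l); rewrite mulrDr.
    by apply: idealD => //; [apply: colonS Ia; exact: leq_maxl|
                             apply: colonS Ib; exact: leq_maxr].
  - by move=> a b [k Ib]; exists k; rewrite mulrCA; exact: idealMl.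
have [|s sE] := fg_saturated IU.
  by move=> b [k Ib]; exists k.+1; rewrite exprSr -mulrA.
have [N HN] : exists N, forall b, b \in s -> I (x ^+ N * b).
  have : forall b, b \in s -> U b by move=> b /span_mem; rewrite sE.
  elim: s {sE} => [|b s IH] sU; first by exists 0%N.
  have [k Ib] := sU b (mem_head _ _).
  have [|N HN] := IH; first by move=> c cs; apply: sU; rewrite inE cs orbT.
  exists (maxn k N) => c; rewrite inE => /orP[/eqP->|/HN Ic].
    by apply: colonS Ib; exact: leq_maxl.
  by apply: colonS Ic; exact: leq_maxr.
have : exists s, [set b | I (x ^+ N * b)] = span s.
  exists s; rewrite -sE; apply/seteqP; split=> [b Ib|]; first by exists N.
  by rewrite sE; exact: span_sub.
elim: N I II {colonI colonS U IU s sE HN} => [|N IH] I II [s sE].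
  by exists s; rewrite -sE; apply/seteqP; split=> b; rewrite /= mul1r.
apply: fg_colon => //; apply: IH; last first.
  by exists s; rewrite -sE; apply/seteqP; split=> b /=; rewrite mulrA -exprS.
split=> /=; first by rewrite mulr0; exact: ideal0.
- by move=> a b Ia Ib; rewrite mulrDr; exact: idealD.
- by move=> a b Ib; rewrite mulrCA; exact: idealMl.
Qed.
End PowerSeriesNoetherian.

(** * Power series in several variables *)

Section FpsCoefficients.
Variables (n : nat) (R : comNzRingType).
Local Notation S := (fps n R).
Local Notation X := (fpsX R).
Implicit Types (f g h : S) (m : 'X_{1..n}).

Lemma fps_coefD f g m : (f + g) m = f m + g m. Proof. by []. Qed.
Lemma fps_coefB f g m : (f - g) m = f m - g m. Proof. by []. Qed.
Lemma fps_coef1 m : (1 : S) m = (m == 0%MM)%:R. Proof. by []. Qed.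

Lemma fps_coefC (c : R) m : fpsC n c m = if m == 0%MM then c else 0. Proof. by []. Qed.
Lemma fps_coefX i m : X i m = (m == U_(i)%MM)%:R. Proof. by []. Qed.

Lemma fps_coef_sum (I : Type) (r : seq I) (P : pred I) (F : I -> S) m :
  (\sum_(i <- r | P i) F i) m = \sum_(i <- r | P i) F i m.
Proof. by apply: (big_morph (fun f : S => f m)). Qed.

(** Decompositions of m as a plain sequence, freed from the degree bounds in the index type, so that
    sums over them can be reindexed. *)
Definition mnm_pairs m : seq ('X_{1..n} * 'X_{1..n}) :=
  [seq (bmnm k.1, bmnm k.2) |
    k <- enum [pred k : 'X_{1..n < (mdeg m).+1, (mdeg m).+1} |
                 m == (k.1 + k.2)%MM]].

Lemma mnm_pairs_uniq m : uniq (mnm_pairs m).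
Proof.
rewrite map_inj_uniq ?enum_uniq // => -[a b] [c d] /= [ac bd].
by congr (_, _); apply: val_inj.
Qed.

Lemma mem_mnm_pairs m p : (p \in mnm_pairs m) = (m == (p.1 + p.2)%MM).
Proof.
apply/mapP/idP => [[k]|mE]; first by rewrite mem_enum inE => ? ->.
have [p1 p2] : (mdeg p.1 < (mdeg m).+1)%N /\ (mdeg p.2 < (mdeg m).+1)%N.
  by rewrite (eqP mE) mdegD !ltnS leq_addr leq_addl.
exists (BMultinom p1, BMultinom p2); first by rewrite mem_enum inE.
by case: p mE p1 p2.
Qed.

Lemma fps_coefM f g m : (f * g) m = \sum_(p <- mnm_pairs m) f p.1 * g p.2.
Proof. by rewrite big_map big_enum_cond; apply: eq_bigl => k; rewrite andbT. Qed.

Lemma fps_coefM_eq0 f g m :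
  (forall k1 k2, m = (k1 + k2)%MM -> f k1 = 0 \/ g k2 = 0) -> (f * g) m = 0.
Proof.
move=> H; rewrite fps_coefM big_seq big1 // => -[k1 k2].
by rewrite mem_mnm_pairs => /eqP/H/= [->|->]; rewrite ?mul0r ?mulr0.
Qed.

Lemma fps_coefM_eq1 f g k1 k2 :
  (forall l1 l2, (k1 + k2 = l1 + l2)%MM -> l1 <> k1 -> f l1 = 0 \/ g l2 = 0) ->
  (f * g) (k1 + k2)%MM = f k1 * g k2.
Proof.
move=> H; rewrite fps_coefM (bigD1_seq (k1, k2)) ?mnm_pairs_uniq ?mem_mnm_pairs //=.
rewrite big_seq_cond big1 ?addr0 // => -[l1 l2].
rewrite mem_mnm_pairs /= => /andP[/eqP E ne].
have [|->|->] := H _ _ E; rewrite ?mul0r ?mulr0 // => l1k1; move/eqP: ne; apply.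
by move: E; rewrite l1k1 => /addmI ->.
Qed.

Lemma fps_coefM0 f g : (f * g) 0%MM = f 0%MM * g 0%MM.
Proof.
rewrite -{1}(addm0 0%MM) fps_coefM_eq1 // => l1 l2; rewrite addm0 => /esym/eqP.
by rewrite mnmD_eq0 => /andP[/eqP->].
Qed.

Lemma fps_coefXM i g m : (X i * g) m = if m i == 0%N then 0 else g (m - U_(i))%MM.
Proof.
case: ifPn => [/eqP mi|mi].
  apply: fps_coefM_eq0 => k1 k2 mE /=; case: eqP => [k1E|]; [right|by left].
  by move: mi; rewrite mE mnmDE k1E mnm1E eqxx.
have mE : (U_(i) + (m - U_(i)))%MM = m by rewrite addmC submK // lep1mP.
rewrite -{1}mE fps_coefM_eq1 /= ?eqxx ?mul1r // => l1 l2 _ /eqP/negbTE->.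
by left.
Qed.

Lemma fps_coefCM c g m : (fpsC n c * g) m = c * g m.
Proof.
rewrite -{1}(add0m m) fps_coefM_eq1 /= ?eqxx // => l1 l2 _ /eqP/negbTE->.
by left.
Qed.

Lemma fpsC_is_additive : zmod_morphism (@fpsC n R).
Proof. by move=> a b; apply: fpsP => m /=; case: eqP; rewrite ?subrr. Qed.
HB.instance Definition _ := GRing.isZmodMorphism.Build R S (@fpsC n R) fpsC_is_additive.
Lemma fpsC_is_multiplicative : monoid_morphism (@fpsC n R).
Proof.
split; first by apply: fpsP => m /=; case: eqP.
by move=> a b; apply: fpsP => m; rewrite fps_coefCM /=; case: eqP; rewrite ?mulr0.
Qed.
HB.instance Definition _ :=
  GRing.isMonoidMorphism.Build R S (@fpsC n R) fpsC_is_multiplicative.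

Lemma fps_decomp g : exists2 h : 'I_n -> S,
  g = fpsC n (g 0%MM) + \sum_i X i * h i & forall i, h i 0%MM = g U_(i)%MM.
Proof.
(* A nonconstant monomial is attributed to the first variable that occurs in it, so it is counted in
   exactly one summand. *)
exists (fun i : 'I_n => Fps (fun m =>
    if [forall j : 'I_n, (j < i)%N ==> (m j == 0%N)]
    then g (m + U_(i))%MM else 0)) => [|i]; last first.
  rewrite /= add0m; case: ifPn => // /negP[].
  by apply/forallP => j; rewrite mnm0E implybT.
apply: fpsP => m; rewrite fps_coefD fps_coef_sum.
have [->|m0] := eqVneq m 0%MM.
  by rewrite big1 => [|i _]; rewrite ?fps_coefXM ?mnm0E //= eqxx addr0.
have /existsP[i0 mi0] : [exists i, m i != 0%N].
  rewrite -negb_forall; apply: contra m0 => /forallP m0.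
  by apply/eqP/mnmP => j; rewrite mnm0E; exact/eqP.
have [i mi imin] := @arg_minnP _ i0 (fun i => m i != 0%N) val mi0.
rewrite fps_coefC (negbTE m0) add0r (bigD1 i) // fps_coefXM (negbTE mi).
rewrite [X in _ = X + _]/= ifT; last first.
  apply/forallP => j; apply/implyP => ji; rewrite mnmBE.
  have : ~~ (m j != 0%N) by apply/negP => /imin; rewrite leqNgt ji.
  by rewrite negbK => /eqP->.
rewrite submK ?lep1mP // big1 ?addr0 // => j ji.
rewrite fps_coefXM; case: eqP => // mj /=; rewrite ifF //; apply/negP => /forallP/(_ i).
have ij : (i < j)%N.
  by rewrite ltn_neqAle imin ?andbT; [apply: contra ji => /eqP/val_inj->|exact/eqP].
by rewrite ij mnmBE mnm1E (negbTE ji) subn0 (negbTE mi).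
Qed.

(** * Fixed points of contractions for a weight filtration *)

Section Contraction.
Variables (w : 'X_{1..n} -> nat).
Hypothesis wD : forall m k : 'X_{1..n}, w (m + k)%MM = (w m + w k)%N.

Definition fps_vanish d g := forall m, (w m < d)%N -> g m = 0.

Lemma fps_vanishM a b f g :
  fps_vanish a f -> fps_vanish b g -> fps_vanish (a + b) (f * g).
Proof.
move=> fa gb m wm; apply: fps_coefM_eq0 => k1 k2 mE; move: wm; rewrite mE wD => wm.
have [k1a|k1a] := ltnP (w k1) a; [left; exact: fa|right; apply: gb; lia].
Qed.

Variable T : S -> S.
Hypothesis TB : forall f g, T (f - g) = T f - T g.
Hypothesis T_vanish : forall d g, fps_vanish d g -> fps_vanish d.+1 (T g).

Lemma fps_fixpoint_unique q : q = T q -> q = 0.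
Proof.
move=> qE; have H d : fps_vanish d q.
  by elim: d => [m //|d IH]; rewrite qE; exact: T_vanish.
by apply: fpsP => m; rewrite (H (w m).+1).
Qed.

(** The iterates from 0 agree in weights below d from the d-th on, so the coefficient of q at m can
    be read off the iterate of index [(w m).+1]. *)
Lemma fps_fixpoint b : exists q, q = b + T q.
Proof.
pose s := fix s k := if k is k'.+1 then b + T (s k') else 0.
have sS d : fps_vanish d (s d.+1 - s d).
  elim: d => [m //|d IH] /=; rewrite opprD addrACA subrr add0r -TB.
  exact: T_vanish.
have sE d l : (d <= l)%N -> fps_vanish d (s l - s d).
  elim: l => [|l IH]; first by rewrite leqn0 => /eqP-> m; rewrite subrr.
  rewrite leq_eqVlt => /orP[/eqP->|dl] m; first by rewrite subrr.
  move=> md; rewrite -(subrK (s l) (s l.+1)) -addrA fps_coefD (IH dl) // addr0.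
  by apply: sS; exact: leq_trans md dl.
pose q : S := Fps (fun m => s (w m).+1 m).
have qs d : fps_vanish d (q - s d).
  move=> m md; apply/eqP; rewrite fps_coefB -[q m]/(s (w m).+1 m).
  rewrite subr_eq0 eq_sym -subr_eq0 -fps_coefB.
  by rewrite (sE (w m).+1).
exists q; apply: fpsP => m; apply/eqP; rewrite -subr_eq0 -fps_coefB; apply/eqP.
have -> : q - (b + T q) = (q - s (w m).+2) - T (q - s (w m).+1).
  by rewrite TB /= opprD opprB opprD; ring.
by rewrite fps_coefB (qs (w m).+2) // (T_vanish (qs (w m).+1)) // subr0.
Qed.
End Contraction.

(** The geometric series as a fixed point: with g = g(0) - g', the inverse solves q = c + c g' q, a
    contraction for the total degree. *)
Lemma fps_inv g c : c * g 0%MM = 1 -> exists h, g * h = 1.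
Proof.
move=> cg; pose g' := fpsC n (g 0%MM) - g.
have g'1 : fps_vanish mdeg 1 g'.
  move=> m; rewrite ltnS leqn0 mdeg_eq0 => /eqP->.
  by rewrite /g' fps_coefB /= eqxx subrr.
have [||q qE] := @fps_fixpoint mdeg (fun q => fpsC n c * (g' * q)) _ _ (fpsC n c).
- by move=> a b; rewrite !mulrBr.
- move=> d q qd m md; rewrite fps_coefCM (fps_vanishM (@mdegD n) g'1 qd) ?mulr0 //.
exists q.
have -> : g * q = fpsC n (g 0%MM) * q - g' * q by rewrite /g'; ring.
have Cg : fpsC n c * fpsC n (g 0%MM) = 1 by rewrite -rmorphM cg rmorph1.
rewrite {1}qE; move: (g' * q) => z.
have -> : fpsC n (g 0%MM) * (fpsC n c + fpsC n c * z) - z =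
  (fpsC n c * fpsC n (g 0%MM)) * (1 + z) - z by ring.
by rewrite Cg; ring.
Qed.

End FpsCoefficients.

(** The image of phi is a face of the monoid of monomials, closed under taking summands, so no
    decomposition of [phi m] is missed. It serves both for setting a variable to 0 and for
    exchanging two variables. *)
Lemma fps_coefM_face (R : comNzRingType) n k (phi : 'X_{1..n} -> 'X_{1..k})
    (f g : fps k R) m :
  injective phi -> (forall a b, phi (a + b)%MM = (phi a + phi b)%MM) ->
  (forall k1 k2, phi m = (k1 + k2)%MM -> exists a b, k1 = phi a /\ k2 = phi b) ->
  (f * g) (phi m) = (Fps (fun l => f (phi l)) * Fps (fun l => g (phi l)) : fps n R) m.
Proof.
move=> phiI phiD phi_sat; rewrite !fps_coefM.
rewrite (perm_big (map (fun p => (phi p.1, phi p.2)) (mnm_pairs m))) /=.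
  by rewrite big_map.
apply: uniq_perm; first exact: mnm_pairs_uniq.
  rewrite map_inj_uniq ?mnm_pairs_uniq // => -[a b] [c d] E.
  by congr (_, _); apply: phiI; [exact: (congr1 fst E)|exact: (congr1 snd E)].
move=> [k1 k2]; rewrite mem_mnm_pairs /=; apply/eqP/mapP => [E|[[l1 l2]]].
  have [a [b [k1E k2E]]] := phi_sat _ _ E; exists (a, b); last by rewrite k1E k2E.
  by rewrite mem_mnm_pairs /=; apply/eqP/phiI; rewrite phiD -k1E -k2E.
rewrite mem_mnm_pairs /= => /eqP -> E.
by rewrite phiD (congr1 fst E : k1 = _) (congr1 snd E : k2 = _).
Qed.

Section FpsDomain.
Variables (n : nat) (R : idomainType).
Implicit Types f g : fps n R.

Lemma fps_min_mnm f : f <> 0 ->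
  exists2 m, f m != 0 & forall k, (k < m)%O -> f k = 0.
Proof.
move=> f0; apply: contrapT => nmin; apply: f0; apply: fpsP => m.
elim/(well_founded_ind (@ltom_wf n)): m => m IH.
apply/eqP; apply: contrapT => /negP fm; apply: nmin; exists m => // k; exact: IH.
Qed.

(** For a monomial order, the product of the lowest monomials of f and g arises in only one way with
    nonzero coefficients. *)
Lemma fps_mulf_eq0 f g : f * g = 0 -> f = 0 \/ g = 0.
Proof.
move=> fg0; apply: contrapT.
move=> /not_orP[/fps_min_mnm[k1 f1 k1min] /fps_min_mnm[k2 g2 k2min]].
have : (f * g) (k1 + k2)%MM != 0.
  rewrite fps_coefM_eq1 ?mulf_neq0 // => l1 l2 E ne.
  have [l1k1|k1l1] := ltP l1 k1; first by left; exact: k1min.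
  have [l2k2|k2l2] := ltP l2 k2; first by right; exact: k2min.
  have : ((k1 + k2)%MM < (l1 + l2)%MM)%O.
    by apply: ltmc_le_add => //; rewrite lt_neqAle k1l1 andbT eq_sym; exact/eqP.
  by rewrite E ltxx.
by rewrite fg0 eqxx.
Qed.
End FpsDomain.

(** * Embedding dimension *)

Section FiniteGenerators.
Variable R : comPzRingType.

Lemma ideal_gen_rangeP d (w : 'I_d -> R) u :
  ideal_set (ideal_gen (range w)) u <-> exists a : 'I_d -> R, u = \sum_i a i * w i.
Proof.
split; last first.
  move=> [a ->]; apply: ideal_sum => [|i _]; first exact: idealP.
  by apply: (idealMl _ (idealP _)); apply: ideal_genS; exists i.
apply: (@ideal_gen_sub _ _ [set u | exists a : 'I_d -> R, u = \sum_i a i * w i]).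
  split.
  - by exists (fun=> 0); rewrite big1 // => i _; rewrite mul0r.
  - move=> _ _ [a ->] [b ->]; exists (fun i => a i + b i).
    by rewrite -big_split; apply: eq_bigr => i _; rewrite mulrDl.
  - move=> c _ [a ->]; exists (fun i => c * a i).
    by rewrite mulr_sumr; apply: eq_bigr => i _; rewrite mulrA.
move=> _ [i _ <-]; exists (fun j => (j == i)%:R).
rewrite (bigD1 i) //= eqxx mul1r big1 ?addr0 // => j /negbTE->; exact: mul0r.
Qed.

(** If d < N, padding both factors with zeros makes them square with the same product, and a zero
    column gives determinant 0 = 1. *)
Lemma mulmx_eq1_size N d (A : 'M[R]_(N, d)) (B : 'M[R]_(d, N)) :
  A *m B = 1%:M -> (1 : R) <> 0 -> (N <= d)%N.
Proof.
move=> AB1 R10; rewrite leqNgt; apply/negP => dN; apply: R10.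
have [e eE] : exists e, N = (d + e.+1)%N by exists (N - d.+1)%N; lia.
subst N; have : \det (row_mx A (0 : 'M_(_, e.+1)) *m col_mx B 0) = 1.
  by rewrite mul_row_col mulmx0 addr0 AB1 det1.
rewrite det_mulmx (expand_det_col _ (rshift d ord0)) big1 ?mul0r // => i _.
by rewrite row_mxEr mxE mul0r.
Qed.

End FiniteGenerators.

Section EmbeddingDimension.
Variable R : comPzRingType.
Variables (M : set R) (N : nat) (z : 'I_N -> R).
Hypothesis ME : M = ideal_gen (range z).
Hypothesis M1 : ~ M 1.

Fact gen_ideal : is_ideal M. Proof. by rewrite ME; exact: idealP. Qed.
Let IM := gen_ideal.

Lemma gen_mulE g : ideal_pow M 2 g <-> exists2 a : 'I_N -> R,
  g = \sum_i a i * z i & forall i, M (a i).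
Proof.
have Mz i : M (z i) by rewrite ME; apply: ideal_genS; exists i.
split; last first.
  move=> [a -> Ma]; apply: ideal_sum => [|i _]; first exact: ideal_pow_ideal.
  have M1z : ideal_pow M 1 (z i) by rewrite ideal_pow1.
  exact: ideal_mulM.
apply: (@ideal_gen_sub _ _ [set g | exists2 a : 'I_N -> R,
  g = \sum_i a i * z i & forall i, M (a i)]).
  split.
  - exists (fun=> 0); first by rewrite big1 // => i _; rewrite mul0r.
    by move=> i; exact: ideal0.
  - move=> _ _ [a -> Ma] [b -> Mb]; exists (fun i => a i + b i).
      by rewrite -big_split; apply: eq_bigr => i _; rewrite mulrDl.
    by move=> i; exact: idealD.
  - move=> c _ [a -> Ma]; exists (fun i => c * a i).
      by rewrite mulr_sumr; apply: eq_bigr => i _; rewrite mulrA.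
    by move=> i; exact: idealMl.
move=> _ [x [y [Mx My ->]]]; have {My} : ideal_pow M 1 y by [].
rewrite ideal_pow1 // {1}ME => /ideal_gen_rangeP[a ->]; exists (fun i => x * a i).
  by rewrite mulr_sumr; apply: eq_bigr => i _; rewrite mulrA.
by move=> i; exact: idealMr.
Qed.

(** Passing to the quotient by F in M^2 does not change M/M^2, in which the z_i are independent.
    Expressing z through w and w through z gives two matrices over R/M whose product is the identity
    of size N. *)
Lemma quo_generators_bound F d (w : 'I_d -> quo (ideal_gen [set F])) :
  (forall a : 'I_N -> R, ideal_pow M 2 (\sum_i a i * z i) -> forall i, M (a i)) ->
  ideal_pow M 2 F ->
  quo_proj (ideal_gen [set F]) @` M = ideal_gen (range w) -> (N <= d)%N.
Proof.
move=> indep M2F pM; set p := quo_proj _ in pM *.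
have IM2 := ideal_pow_ideal M 2.
have sFM2 : ideal_set (ideal_gen [set F]) `<=` ideal_pow M 2.
  by apply: ideal_gen_sub => // _ ->.
have sFM : ideal_set (ideal_gen [set F]) `<=` M.
  by apply: (subset_trans sFM2); rewrite -{2}(ideal_pow1 IM); exact: ideal_pow_anti.
have Mz i : M (z i) by rewrite ME; apply: ideal_genS; exists i.
have /choice[w' w'P] j : exists x, M x /\ p x = w j.
  have : ideal_set (ideal_gen (range w)) (w j) by apply: ideal_genS; exists j.
  by rewrite -pM => -[x Mx xE]; exists x.
have /choice[s sP] j : exists a : 'I_N -> R, w' j = \sum_k a k * z k.
  by apply/ideal_gen_rangeP; rewrite -ME; have [] := w'P j.
have /choice[r rP] i : exists a : 'I_d -> R, ideal_pow M 2 (z i - \sum_j a j * w' j).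
  have : (p @` M) (p (z i)) by exists (z i).
  rewrite pM => /ideal_gen_rangeP[u uE]; exists (fun j => repr (u j)); apply: sFM2.
  apply/quo_eqP; rewrite -/p uE /p rmorph_sum; apply: eq_bigr => j _.
  by rewrite rmorphM /= -/p (w'P j).2 /p quo_projK.
pose q := quo_proj (Ideal IM).
apply: (@mulmx_eq1_size (quo (Ideal IM)) _ _
  (\matrix_(i, j) q (r i j)) (\matrix_(j, k) q (s j k))); last first.
  by rewrite -(rmorph1 q) => /quo_proj0P.
apply/matrixP => i k; rewrite !mxE -(rmorph_nat q).
under eq_bigr do rewrite !mxE -rmorphM.
rewrite -rmorph_sum; apply/esym/quo_eqP.
(* These coefficients give the combination z_i - sum_j r_ij w'_j, which lies in M^2. *)
apply: (indep (fun k => (i == k)%:R - \sum_j r i j * s j k)) => {k}.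
under eq_bigr do rewrite mulrBl.
rewrite sumrB (bigD1 i) //= eqxx mul1r big1 ?addr0; last first.
  by move=> j; rewrite eq_sym => /negbTE->; rewrite mul0r.
under [X in _ - X]eq_bigr do rewrite mulr_suml.
rewrite exchange_big /=.
under [X in _ - X]eq_bigr => j _
  do [under eq_bigr do rewrite -mulrA; rewrite -mulr_sumr -sP].
exact: rP.
Qed.

(** M is the only prime containing its N generators, so the height bound applies to chains ending at
    M; any other chain is first extended by M. *)
Lemma local_dim_bound h (c : nat -> set R) : noetherian R ->
  (forall x, ~ M x -> exists y, x * y = 1) -> prime_chain h c -> (h <= N)%N.
Proof.
move=> nR Minv; have pM : is_prime M.
  split=> // x y Mxy; apply: contrapT => /not_orP[/Minv[x' xx'] /Minv[y' yy']].
  apply: M1; have <- : x' * y' * (x * y) = 1.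
    have -> : x' * y' * (x * y) = (x * x') * (y * y') by ring.
    by rewrite xx' yy' mulr1.
  exact: idealMl.
have sM P : is_prime P -> P `<=` M.
  move=> [IP P1 _] x Px; apply: contrapT => /Minv[y xy].
  by apply: P1; rewrite -xy; exact: idealMr.
have endM k e : prime_chain k e -> e k = M -> (k <= N)%N.
  move=> ce eM; have -> : N = size (codom z) by rewrite size_codom card_ord.
  apply: (prime_chain_bound nR ce) => [P pP _ zP _|_ /codomP[i ->]]; rewrite eM.
    apply/seteqP; split; first exact: sM.
    rewrite ME; apply: ideal_gen_sub; first exact: prime_ideal.
    by move=> _ [i _ <-]; apply: zP; exact: codom_f.
  by rewrite ME; apply: ideal_genS; exists i.
move=> cc; case: (pselect (c h = M)) => [/endM|nM]; first exact.
apply: ltnW; apply: (endM h.+1 (fun i => if (i <= h)%N then c i else M)); last first.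
  by rewrite ltnn.
have [pc cS] := cc; split=> i ih; first by case: ifP => // ih'; exact: pc.
rewrite -ltnS ih; case: ifP => [ih'|]; first exact: cS.
move=> /negbT; rewrite -ltnNge ltnS => hi; have -> : i = h by lia.
by apply: proper_subsetP => //; apply: sM; exact: pc.
Qed.

End EmbeddingDimension.

Lemma quo_generators (R : comPzRingType) (M : set R) d (z : 'I_d.+1 -> R) F :
  M = ideal_gen (range z) ->
  (forall x, ~ M x -> exists y, x * y = 1) -> M F -> ~ ideal_pow M 2 F ->
  exists w : 'I_d -> quo (ideal_gen [set F]),
    quo_proj (ideal_gen [set F]) @` M = ideal_gen (range w).
Proof.
move=> ME Minv MF M2F; set p := quo_proj _.
have /ideal_gen_rangeP[a FE] : ideal_set (ideal_gen (range z)) F by rewrite -ME.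
have [i nMa] : exists i, ~ M (a i).
  by apply/existsNP => Ma; apply: M2F; apply/(gen_mulE ME); exists a.
have [b ab1] := Minv _ nMa.
exists (fun j => p (z (lift i j))).
rewrite ME image_ideal_gen; last exact: quo_proj_surj.
have IG := idealP (ideal_gen (range (fun j => p (z (lift i j))))).
apply: ideal_gen_eqP => //.
- exact: idealP.
- move=> _ [j _ <-]; apply: ideal_genS; exists (z (lift i j)) => //; exists (lift i j).
- apply: ideal_gen_sub => // _ [_ [j _ <-] <-].
  case: (unliftP i j) => [k ->|->]; first by apply: ideal_genS; exists k.
  have pF : p F = 0 by apply/quo_proj0P; exact: ideal_genS.
  (* The relation F = 0 is solved for [z i], whose coefficient has inverse b modulo F. *)
  have zE : p (z i) = p b * (p F - p (\sum_(k < d) a (lift i k) * z (lift i k))).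
    rewrite -rmorphB -rmorphM /=; congr p.
    by rewrite FE (bigD1_ord i) //= addrK mulrA (mulrC b) ab1 mul1r.
  move: zE; rewrite pF sub0r /= -/p => ->.
  apply: (idealMl _ IG); apply: (idealN IG).
  rewrite /p rmorph_sum; apply: (ideal_sum _ IG) => k _; rewrite rmorphM.
  by apply: (idealMl _ IG); apply: ideal_genS; exists k.
Qed.

(** * Substitutions and noetherianity of power series rings *)

Section Restriction.
Variables (n : nat) (R : comNzRingType).
Implicit Types (f g : fps n R) (A : {pred 'I_n}).

Definition on_face A (m : 'X_{1..n}) := [forall j, (j \in A) ==> (m j == 0%N)].

Lemma on_faceD A m k : on_face A (m + k)%MM = on_face A m && on_face A k.
Proof.
apply/forallP/andP => [H|[/forallP Hm /forallP Hk] j].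
  split; apply/forallP => j; apply/implyP => /(implyP (H j)); rewrite mnmDE addn_eq0;
  by case/andP.
apply/implyP => jA; rewrite mnmDE addn_eq0.
by rewrite (implyP (Hm j) jA) (implyP (Hk j) jA).
Qed.

Lemma on_face0 A : on_face A 0%MM.
Proof. by apply/forallP => j; rewrite mnm0E implybT. Qed.

(* The substitution x_j := 0 for j in A. *)
Definition fps_restrict A f : fps n R :=
  Fps (fun m => if on_face A m then f m else 0).

Lemma fps_restrictE A f m : fps_restrict A f m = if on_face A m then f m else 0.
Proof. by []. Qed.

Lemma fps_restrict_id A f : fps_restrict A (fps_restrict A f) = fps_restrict A f.
Proof. by apply: fpsP => m; rewrite !fps_restrictE; case: (on_face A m). Qed.

Fact fps_restrict_is_additive A : zmod_morphism (fps_restrict A).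
Proof. by move=> f g; apply: fpsP => m /=; case: ifP => //; rewrite subr0. Qed.
HB.instance Definition _ A := GRing.isZmodMorphism.Build (fps n R) (fps n R)
  (fps_restrict A) (fps_restrict_is_additive A).

Fact fps_restrict_is_multiplicative A : monoid_morphism (fps_restrict A).
Proof.
split=> [|f g]; apply: fpsP => m; rewrite fps_restrictE.
  by rewrite fps_coef1; case: eqP => [->|]; rewrite ?on_face0 //; case: ifP.
case: ifP => [Am|nAm].
  rewrite !fps_coefM big_seq [RHS]big_seq; apply: eq_bigr => k.
  rewrite mem_mnm_pairs => /eqP mE; move: Am; rewrite mE on_faceD => /andP[A1 A2].
  by rewrite !fps_restrictE A1 A2.
apply/esym/fps_coefM_eq0 => k1 k2 mE; move: nAm; rewrite mE on_faceD !fps_restrictE.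
by case: (on_face A k1); case: (on_face A k2) => // _; [right|left|left].
Qed.
HB.instance Definition _ A := GRing.isMonoidMorphism.Build (fps n R) (fps n R)
  (fps_restrict A) (fps_restrict_is_multiplicative A).

End Restriction.

(** * Adding one variable *)

Section Noetherian.
Variable R : comNzRingType.
Variable n : nat.
Let y : 'I_n.+1 := ord_max.

Definition mnm_wid (m : 'X_{1..n}) : 'X_{1..n.+1} :=
  [multinom (if unlift y i is Some j then m j else 0%N) | i < n.+1].
Definition mnm_drop (m : 'X_{1..n.+1}) : 'X_{1..n} := [multinom m (lift y i) | i < n].

Lemma mnm_widK : cancel mnm_wid mnm_drop.
Proof. by move=> m; apply/mnmP => i; rewrite !mnmE liftK. Qed.

Lemma mnm_wid_y (m : 'X_{1..n}) : mnm_wid m y = 0%N.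
Proof. by rewrite mnmE unlift_none. Qed.

Lemma mnm_dropK (m : 'X_{1..n.+1}) : m y = 0%N -> mnm_wid (mnm_drop m) = m.
Proof.
move=> my; apply/mnmP => i; rewrite mnmE.
by case: unliftP => [j ->|->]; rewrite ?mnmE ?my.
Qed.

Lemma mnm_widD m k : mnm_wid (m + k)%MM = (mnm_wid m + mnm_wid k)%MM.
Proof. by apply/mnmP => i; rewrite !mnmE; case: unlift => // j; rewrite mnmDE. Qed.

Lemma mnm_wid0 : mnm_wid 0%MM = 0%MM.
Proof. by apply/mnmP => i; rewrite mnmE mnm0E; case: unlift => // j; rewrite mnm0E. Qed.

Definition fps_drop (g : fps n.+1 R) : fps n R := Fps (fun m => g (mnm_wid m)).
Definition fps_widen (g : fps n R) : fps n.+1 R :=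
  Fps (fun m => if m y == 0%N then g (mnm_drop m) else 0).

Lemma fps_dropE g m : fps_drop g m = g (mnm_wid m). Proof. by []. Qed.
Lemma fps_widenE g m : fps_widen g m = if m y == 0%N then g (mnm_drop m) else 0.
Proof. by []. Qed.

Lemma fps_widenK g : fps_drop (fps_widen g) = g.
Proof. by apply: fpsP => m; rewrite fps_dropE fps_widenE mnm_wid_y eqxx mnm_widK. Qed.

Fact fps_drop_is_additive : zmod_morphism fps_drop. Proof. by []. Qed.
HB.instance Definition _ := GRing.isZmodMorphism.Build (fps n.+1 R) (fps n R)
  fps_drop fps_drop_is_additive.

Fact fps_drop_is_multiplicative : monoid_morphism fps_drop.
Proof.
split=> [|f g]; apply: fpsP => m; rewrite fps_dropE.
  by rewrite !fps_coef1 -mnm_wid0 (can_eq mnm_widK).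
apply: fps_coefM_face; [exact: (can_inj mnm_widK)|exact: mnm_widD|move=> k1 k2 E].
have : (k1 y + k2 y)%N = 0%N by rewrite -mnmDE -E mnm_wid_y.
move=> /eqP; rewrite addn_eq0 => /andP[/eqP k1y /eqP k2y].
by exists (mnm_drop k1), (mnm_drop k2); rewrite !mnm_dropK.
Qed.
HB.instance Definition _ := GRing.isMonoidMorphism.Build (fps n.+1 R) (fps n R)
  fps_drop fps_drop_is_multiplicative.

Fact fps_widen_is_additive : zmod_morphism fps_widen.
Proof.
move=> f g; apply: fpsP => m; rewrite fps_coefB !fps_widenE.
by case: ifP => //; rewrite subr0.
Qed.
HB.instance Definition _ := GRing.isZmodMorphism.Build (fps n R) (fps n.+1 R)
  fps_widen fps_widen_is_additive.

Fact fps_widen_is_multiplicative : monoid_morphism fps_widen.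
Proof.
(* A series without y is recovered from its image under [fps_drop], whose multiplicativity is
   already known. *)
have iotaE (g : fps n.+1 R) : (forall m : 'X_{1..n.+1}, m y != 0%N -> g m = 0) ->
    fps_widen (fps_drop g) = g.
  move=> gy; apply: fpsP => m; rewrite fps_widenE; case: ifPn => [/eqP my|/gy//].
  by rewrite fps_dropE mnm_dropK.
split=> [|f g].
  rewrite -[in LHS](rmorph1 fps_drop); apply: iotaE => m my; rewrite fps_coef1.
  by case: eqP => // m0; move: my; rewrite m0 mnm0E.
rewrite -{1}(fps_widenK f) -{1}(fps_widenK g) -rmorphM; apply: iotaE => m my.
apply: fps_coefM_eq0 => k1 k2 mE; rewrite !fps_widenE.
case: eqP => [k1y|]; [right|by left].
by case: eqP => // k2y; move: my; rewrite mE mnmDE k1y k2y.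
Qed.
HB.instance Definition _ := GRing.isMonoidMorphism.Build (fps n R) (fps n.+1 R)
  fps_widen fps_widen_is_multiplicative.

Lemma fps_noetherianS : noetherian (fps n R) -> noetherian (fps n.+1 R).
Proof.
pose x : fps n.+1 R := fpsX R y.
pose D (g : fps n.+1 R) : fps n.+1 R := Fps (fun m => g (m + U_(y))%MM).
pose w (m : 'X_{1..n.+1}) := m y.
have wD m k : w (m + k)%MM = (w m + w k)%N by exact: mnmDE.
have x1 : fps_vanish w 1 x.
  move=> m; rewrite ltnS leqn0 fps_coefX => /eqP wm.
  by case: eqP => // mE; move: wm; rewrite /w mE mnm1E eqxx.
have xk k : fps_vanish w k (x ^+ k).
  by elim: k => [m //|k IH]; rewrite exprS; exact: fps_vanishM x1 IH.
apply: (@noetherian_power_series _ _ fps_widen fps_drop x D) => /=.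
- exact: fps_widenK.
- move=> g; apply: fpsP => m; rewrite fps_coefD fps_widenE fps_coefXM.
  case: ifPn => [/eqP my|my]; first by rewrite fps_dropE mnm_dropK // addr0.
  by rewrite add0r /= submK // lep1mP.
- move=> g gx; apply: fpsP => m.
  have [c ->] := gx (w m).+1; rewrite mulrC.
  have := fps_vanishM wD (xk (w m).+1) (_ : fps_vanish w 0 c); apply=> //.
  by rewrite addn0.
- move=> a.
  (* The sum of all a_i y^i, written down coefficientwise; splitting off its term without y drives
     the induction on k. *)
  pose q (a : nat -> fps n R) : fps n.+1 R := Fps (fun m => a (m y) (mnm_drop m)).
  have qE (b : nat -> fps n R) : q b = fps_widen (b 0%N) + x * q (fun i => b i.+1).
    apply: fpsP => m; rewrite fps_coefD fps_widenE fps_coefXM /=.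
    case: ifPn => [/eqP->|my]; first by rewrite addr0.
    rewrite add0r mnmBE mnm1E eqxx subn1 prednK ?lt0n //; congr (b _ _).
    by apply/mnmP => i; rewrite !mnmE (negbTE (neq_lift _ _)) subn0.
  exists (q a) => k; elim: k a => [|k IH] b.
    by exists (q b); rewrite big_ord0 subr0 mulr1.
  have [c cE] := IH (fun i => b i.+1); exists c.
  rewrite big_ord_recl mulr1 qE opprD addrACA subrr add0r exprSr mulrA -cE.
  rewrite mulrBl mulrC.
  by congr (_ - _); rewrite mulr_suml; apply: eq_bigr => i _; rewrite /= exprSr mulrA.
Qed.
End Noetherian.

Lemma fps_noetherian (R : comNzRingType) n : noetherian R -> noetherian (fps n R).
Proof.
move=> nR; elim: n => [|n IH]; last exact: fps_noetherianS.
apply: (noetherian_surj (phi := @fpsC 0 R)) nR => g; exists (g 0%MM).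
by apply: fpsP => m; rewrite fps_coefC nvar0_mnmE eqxx.
Qed.

(** * Power series over a discrete valuation ring *)

Section FpsLocal.
Variables (V : idomainType) (pi : V) (n : nat).
Hypothesis noethV : noetherian V.
Hypothesis localV : is_local (ideal_gen [set pi]).
Hypothesis pi_neq0 : pi <> 0.
Local Notation S := (fps n V).
Implicit Types (g : S).

Lemma pi_inv v : ~ principal pi v -> exists c, v * c = 1.
Proof. by rewrite -ideal_gen1 => /local_inv; apply. Qed.

Lemma pi_proper : ~ principal pi 1.
Proof.
have [[_ nT _] _] := localV; rewrite -ideal_gen1; apply: proper_ideal nT.
exact: idealP.
Qed.

Let Ipi := principal_ideal pi.

(** The maximal ideal as a condition on a single coefficient; [fps_max_idealE] links it to the
    generators. *)
Definition fpsM : set S := [set g | principal pi (g 0%MM)].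

Lemma fpsM_ideal : is_ideal fpsM.
Proof.
split; rewrite /fpsM /=; first exact: ideal0.
- by move=> f g; exact: idealD.
- move=> a g; rewrite -[X in _ -> X]/(principal pi ((a * g) 0%MM)) fps_coefM0.
  exact: idealMl.
Qed.

Lemma fpsM1 : ~ fpsM 1.
Proof. by rewrite /fpsM /= eqxx; exact: pi_proper. Qed.

Lemma fpsM_inv g : ~ fpsM g -> exists h, g * h = 1.
Proof. by move=> /pi_inv[c]; rewrite mulrC; exact: fps_inv. Qed.

Definition fps_param (i : 'I_n.+1) : S :=
  if unlift ord0 i is Some j then fpsX V j else fpsC n pi.

Lemma fps_param_sum (a : 'I_n.+1 -> S) :
  \sum_i a i * fps_param i =
  a ord0 * fpsC n pi + \sum_(j < n) a (lift ord0 j) * fpsX V j.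
Proof.
rewrite big_ord_recl /fps_param unlift_none; congr (_ + _).
by apply: eq_bigr => j _; rewrite liftK.
Qed.

Lemma fps_param_sum0 (a : 'I_n.+1 -> S) :
  (\sum_i a i * fps_param i) 0%MM = pi * a ord0 0%MM.
Proof.
rewrite fps_param_sum fps_coefD mulrC fps_coefCM fps_coef_sum big1 ?addr0 // => j _.
by rewrite mulrC fps_coefXM mnm0E eqxx.
Qed.

Lemma fps_param_sum1 (a : 'I_n.+1 -> S) j :
  (\sum_i a i * fps_param i) U_(j)%MM =
  pi * a ord0 U_(j)%MM + a (lift ord0 j) 0%MM.
Proof.
rewrite fps_param_sum fps_coefD mulrC fps_coefCM; congr (_ + _).
rewrite fps_coef_sum (bigD1 j) // big1 => [|i ij]; rewrite mulrC fps_coefXM mnm1E.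
  by rewrite eqxx /= addr0; congr (_ _); apply/mnmP => k; rewrite mnmBE mnm0E subnn.
by rewrite (eq_sym j) (negbTE ij).
Qed.

Lemma fps_param_decomp g : fpsM g -> exists a : 'I_n.+1 -> S,
  [/\ g = \sum_i a i * fps_param i, g 0%MM = pi * a ord0 0%MM
    & forall j, a (lift ord0 j) 0%MM = g U_(j)%MM].
Proof.
move=> [c gc]; have [h gE hE] := fps_decomp g.
exists (fun i => if unlift ord0 i is Some j then h j else fpsC n c); split.
- rewrite fps_param_sum {1}gE gc rmorphM unlift_none; congr (_ + _).
  by apply: eq_bigr => j _; rewrite liftK mulrC.
- by rewrite unlift_none fps_coefC eqxx gc mulrC.
- by move=> j; rewrite liftK.
Qed.

Lemma fpsM_gen : fpsM = ideal_gen (range fps_param).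
Proof.
apply: ideal_gen_eqP; first exact: fpsM_ideal.
  move=> _ [i _ <-]; rewrite /fpsM /fps_param /=; case: unliftP => [j _|_].
    by rewrite fps_coefX eq_sym mnm1_eq0; exact: ideal0.
  by rewrite fps_coefC eqxx; exact: principal_refl.
by move=> g /fps_param_decomp[a [-> _ _]]; apply/ideal_gen_rangeP; exists a.
Qed.

Lemma fps_max_idealE : ideal_set (fps_max_ideal pi n) = fpsM.
Proof.
rewrite fpsM_gen /fps_max_ideal; congr (ideal_set (ideal_gen _)).
apply/seteqP; split=> [g|_ [i _ <-]].
  case=> [->|[j _ <-]]; first by exists ord0 => //; rewrite /fps_param unlift_none.
  by exists (lift ord0 j) => //; rewrite /fps_param liftK.
rewrite /fps_param; case: unliftP => [j _|_]; first by right; exists j.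
by left.
Qed.

(** Compare constant and linear coefficients with those of a combination over the maximal ideal: the
    former determine a_0(0) after cancelling pi, the latter determine the other a_i(0) modulo pi. *)
Lemma fpsM_indep (a : 'I_n.+1 -> S) :
  ideal_pow fpsM 2 (\sum_i a i * fps_param i) -> forall i, fpsM (a i).
Proof.
move=> /(gen_mulE fpsM_gen)[b abE Mb] i; rewrite /fpsM /=.
case: (unliftP ord0 i) => [j|] ->.
  have := congr1 (fun g : S => g U_(j)%MM) abE; rewrite !fps_param_sum1 => E.
  have -> : a (lift ord0 j) 0%MM =
      (b ord0 U_(j)%MM - a ord0 U_(j)%MM) * pi + b (lift ord0 j) 0%MM.
    by apply: (addrI (pi * a ord0 U_(j)%MM)); rewrite E; ring.
  by apply: idealD => //; [exists (b ord0 U_(j)%MM - a ord0 U_(j)%MM)|exact: Mb].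
have := congr1 (fun g : S => g 0%MM) abE; rewrite !fps_param_sum0.
by move=> /(mulfI (introN eqP pi_neq0)) ->; exact: Mb.
Qed.

(** The square contains pi^2 and pi x_j, which accounts for the two exponents of pi. Conversely,
    [fps_param_decomp] writes g with parameter coefficients whose constant terms are g(0)/pi and the
    linear coefficients of g. *)
Lemma fpsM_sqrP g : ideal_pow fpsM 2 g <->
  principal (pi ^+ 2) (g 0%MM) /\ forall i, principal pi (g U_(i)%MM).
Proof.
split=> [/(gen_mulE fpsM_gen)[a -> Ma]|[[c g0] g1]].
  split=> [|i]; rewrite ?fps_param_sum0 ?fps_param_sum1.
    by have [c ->] := Ma ord0; exists c; ring.
  by apply: idealD => //; [exists (a ord0 U_(i)%MM); rewrite mulrC|exact: Ma].
have [|a [gE a0 a1]] := @fps_param_decomp g.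
  by rewrite /fpsM /= g0; exists (c * pi); ring.
apply/(gen_mulE fpsM_gen); exists a => // i; rewrite /fpsM /=.
case: (unliftP ord0 i) => [j|] ->; first by rewrite a1.
exists c; apply: (mulfI (introN eqP pi_neq0)); rewrite -a0 g0; ring.
Qed.

Lemma fps_zero_prime : is_prime ([set 0] : set S).
Proof.
split; last by move=> x y; exact: fps_mulf_eq0.
  split=> //; first by move=> _ _ -> ->; rewrite addr0.
  by move=> a _ ->; rewrite mulr0.
by apply/eqP; exact: oner_neq0.
Qed.

Lemma fps_max_chain : exists c : nat -> set S,
  [/\ prime_chain n.+1 c, c 0%N = [set 0] & c n.+1 = fpsM].
Proof.
(* The kernel of setting the first i variables to 0. These give n+1 primes from 0 upwards, and the
   maximal ideal, which also contains pi, is the last step. *)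
pose P i : set S := fps_restrict [pred j : 'I_n | (j < i)%N] @^-1` [set 0].
have PE i g : P i g <-> forall m, on_face [pred j : 'I_n | (j < i)%N] m -> g m = 0.
  split=> [gi m mi|H].
    by have := congr1 (fun g : S => g m) gi; rewrite fps_restrictE mi.
  by apply: fpsP => m; rewrite fps_restrictE; case: ifP => // /H.
exists (fun i => if (i <= n)%N then P i else fpsM); split; last by rewrite ltnn.
- split=> i; rewrite ?ltnS.
    case: ifP => _ _; first exact: preimage_prime fps_zero_prime.
    split; [exact: fpsM_ideal|exact: fpsM1|move=> f g fg].
    apply: contrapT => /not_orP[/fpsM_inv[f' ff'] /fpsM_inv[g' gg']].
    apply: fpsM1; have <- : f' * g' * (f * g) = 1.
      have -> : f' * g' * (f * g) = (f * f') * (g * g') by ring.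
      by rewrite ff' gg' mulr1.
    by apply: idealMl; [exact: fpsM_ideal|].
  move=> i_n; rewrite i_n; case: ifP => [i1n|i1n].
    split=> [g /PE gi|].
      apply/PE => m /forallP mi; apply: gi; apply/forallP => j; apply/implyP => ji.
      by apply: (implyP (mi j)); exact: ltnW.
    move=> /(_ (fpsX V (Ordinal i1n))).
    have PX k : P k (fpsX V (Ordinal i1n)) <-> (i < k)%N.
      rewrite PE; split=> [X0|ik m].
        rewrite ltnNge; apply/negP => ki.
        have : (1 : V) = 0; last by apply/eqP; exact: oner_neq0.
        rewrite -(X0 U_(Ordinal i1n)%MM); first by rewrite fps_coefX eqxx.
        apply/forallP => j; apply/implyP => jk; rewrite mnm1E eqb0.
        by apply: contraTN jk => /eqP <-; rewrite inE -leqNgt.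
      move=> /forallP/(_ (Ordinal i1n))/implyP/(_ ik) /eqP mi; rewrite fps_coefX.
      by case: eqP => // mE; move: mi; rewrite mE mnm1E eqxx.
    by rewrite !PX ltnn ltnSn => /(_ isT).
  split=> [g /PE gi|]; first by rewrite /fpsM /= gi ?on_face0 //; exact: ideal0.
  move=> MP; apply: pi_neq0; have /PE/(_ 0%MM) : P i (fpsC n pi).
    by apply: MP; rewrite /fpsM /= eqxx; exact: principal_refl.
  by rewrite fps_coefC eqxx; apply; exact: on_face0.
- apply/seteqP; split=> [g /PE g0|_ ->]; last by apply/PE.
  apply: fpsP => m; apply: g0; exact/forallP.
Qed.

Lemma quo_krull_dim F : fpsM F -> F <> 0 ->
  has_krull_dim (quo (ideal_gen [set F])) (Some n).
Proof.
move=> MF F0; have nS := @fps_noetherian _ n noethV; split.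
  have [c [cc c0 cM]] := fps_max_chain.
  (* Exchange F into a maximal chain of V[[x]] and drop its zero ideal. *)
  have [|c' [cc' _ _ c'F]] := prime_chain_exchange nS cc (_ : c n.+1 F).
    by rewrite cM.
  exists (fun i => quo_proj (ideal_gen [set F]) @` c' i.+1).
  apply: (@quo_image_chain _ _ n (fun i => c' i.+1)); first exact: prime_chain_behead.
  apply: ideal_gen_sub; last by move=> _ ->.
  by apply: prime_ideal; have [pc _] := cc'; exact: pc.
(* For the upper bound, the zero ideal is put below the preimages of a chain. As F is nonzero, this
   lengthens the chain by one, within the bound n+1. *)
move=> h [c /quo_preimage_chain[[pc cS] Fc]].
have: (h.+1 <= n.+1)%N; last by rewrite ltnS.
apply: (local_dim_bound fpsM_gen fpsM1 nS fpsM_inv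
  (c := fun i => if i is j.+1 then quo_proj (ideal_gen [set F]) @^-1` c j else [set 0])).
split=> -[|i] ih; [exact: fps_zero_prime|exact: pc| |exact: cS].
have I0 := prime_ideal (pc 0%N isT).
split; first by move=> _ ->; exact: ideal0.
move=> /(_ F) h0; apply: F0; apply: h0; apply: Fc => //; exact: ideal_genS.
Qed.

End FpsLocal.

Arguments fpsM {V} pi n.

(** * Linear Weierstrass division *)

Section InducedIsomorphism.
Variables (A B : comPzRingType) (I : ideal A) (psi : {rmorphism A -> B}).
Hypothesis psi_surj : forall b, exists a, psi a = b.
Hypothesis psi_ker : forall a, psi a = 0 <-> ideal_set I a.

Let lift b : A := sval (cid (psi_surj b)).
Let psi_lift b : psi (lift b) = b. Proof. exact: (svalP (cid (psi_surj b))). Qed.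

(** The inverse of the induced map A/I -> B. With B = V[[x,y]]/f~ and I = (x_1) it has the direction
    required by [fps_sim]. *)
Definition inverse_iso (b : B) : quo I := quo_proj I (lift b).

Lemma inverse_isoE a : inverse_iso (psi a) = quo_proj I a.
Proof. by apply/quo_eqP/psi_ker; rewrite rmorphB psi_lift subrr. Qed.

Fact inverse_iso_is_additive : zmod_morphism inverse_iso.
Proof.
move=> b c; rewrite -(psi_lift b) -(psi_lift c) -rmorphB !inverse_isoE.
exact: rmorphB.
Qed.
HB.instance Definition _ := GRing.isZmodMorphism.Build B (quo I) inverse_iso
  inverse_iso_is_additive.

Fact inverse_iso_is_multiplicative : monoid_morphism inverse_iso.
Proof.
split; first by rewrite -(rmorph1 psi) inverse_isoE rmorph1.
move=> b c; rewrite -(psi_lift b) -(psi_lift c) -rmorphM !inverse_isoE.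
exact: rmorphM.
Qed.
HB.instance Definition _ := GRing.isMonoidMorphism.Build B (quo I) inverse_iso
  inverse_iso_is_multiplicative.

Lemma inverse_isomorphism : exists phi : {rmorphism B -> quo I},
  bijective phi /\ forall a, phi (psi a) = quo_proj I a.
Proof.
exists inverse_iso; split; last exact: inverse_isoE.
exists (fun u => psi (repr u)) => [b|u] /=; last by rewrite inverse_isoE quo_projK.
rewrite -[RHS]psi_lift; apply/eqP; rewrite -subr_eq0 -rmorphB; apply/eqP/psi_ker.
by apply/quo_eqP; rewrite quo_projK.
Qed.
End InducedIsomorphism.

Section Swap.
Variables (R : comNzRingType) (n : nat) (i j : 'I_n).
Implicit Types (g : fps n R) (m : 'X_{1..n}).

Definition mnm_swap m : 'X_{1..n} := [multinom m (tperm i j l) | l < n].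

Lemma mnm_swapK : involutive mnm_swap.
Proof. by move=> m; apply/mnmP => l; rewrite !mnmE tpermK. Qed.

Lemma mnm_swapD m k : mnm_swap (m + k)%MM = (mnm_swap m + mnm_swap k)%MM.
Proof. by apply/mnmP => l; rewrite !mnmE. Qed.

Lemma mnm_swap0 : mnm_swap 0%MM = 0%MM.
Proof. by apply/mnmP => l; rewrite mnmE !mnm0E. Qed.

Definition fps_swap g : fps n R := Fps (fun m => g (mnm_swap m)).

Lemma fps_swapE g m : fps_swap g m = g (mnm_swap m). Proof. by []. Qed.

Lemma fps_swapK : involutive fps_swap.
Proof. by move=> g; apply: fpsP => m; rewrite !fps_swapE mnm_swapK. Qed.

Fact fps_swap_is_additive : zmod_morphism fps_swap. Proof. by []. Qed.
HB.instance Definition _ := GRing.isZmodMorphism.Build (fps n R) (fps n R)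
  fps_swap fps_swap_is_additive.

Fact fps_swap_is_multiplicative : monoid_morphism fps_swap.
Proof.
split=> [|f g]; apply: fpsP => m; rewrite fps_swapE.
  by rewrite !fps_coef1 -{1}mnm_swap0 (inv_eq mnm_swapK) mnm_swapK.
apply: fps_coefM_face; [exact: (inv_inj mnm_swapK)|exact: mnm_swapD|].
by move=> k1 k2 _; exists (mnm_swap k1), (mnm_swap k2); rewrite !mnm_swapK.
Qed.
HB.instance Definition _ := GRing.isMonoidMorphism.Build (fps n R) (fps n R)
  fps_swap fps_swap_is_multiplicative.
End Swap.

Section LinearDivision.
Variables (R : comNzRingType) (n : nat) (j : 'I_n).
Local Notation S := (fps n R).
Local Notation K := (@fps_restrict n R (pred1 j)).
Local Notation X := (fpsX R j).
Implicit Types (f g h : S) (m : 'X_{1..n}).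

Lemma on_face1 m : on_face (pred1 j) m = (m j == 0%N).
Proof.
apply/forallP/idP => [/(_ j)|mj l]; first by rewrite inE eqxx.
by rewrite inE; apply/implyP => /eqP->.
Qed.

(** The difference quotient (g - g|_{x_j = 0}) / x_j. *)
Definition fps_shift g : S := Fps (fun m => g (m + U_(j))%MM).
Local Notation D := fps_shift.

Lemma fps_shiftE g m : D g m = g (m + U_(j))%MM. Proof. by []. Qed.
Lemma fps_shiftB f g : D (f - g) = D f - D g. Proof. exact: fpsP. Qed.
Lemma fps_shiftD f g : D (f + g) = D f + D g. Proof. exact: fpsP. Qed.

Lemma fps_shift_decomp g : g = X * D g + K g.
Proof.
apply: fpsP => m; rewrite fps_coefD fps_coefXM fps_restrictE on_face1.
by case: ifPn => mj; rewrite ?add0r // addr0 fps_shiftE submK // lep1mP.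
Qed.

Lemma fps_shiftX g : D (X * g) = g.
Proof.
apply: fpsP => m; rewrite fps_shiftE fps_coefXM mnmDE mnm1E eqxx addn1 /=.
by rewrite addmK.
Qed.

Lemma fps_shiftK g : D (K g) = 0.
Proof.
apply: fpsP => m; rewrite fps_shiftE fps_restrictE on_face1 mnmDE mnm1E eqxx.
by rewrite addn1.
Qed.

Lemma fps_shift_eq0 g : D g = 0 -> K g = g.
Proof. by move=> Dg; rewrite [RHS]fps_shift_decomp Dg mulr0 add0r. Qed.

(** Series without x_j act as constants for D. *)
Lemma fps_shiftM f h : D (f * K h) = D f * K h.
Proof.
rewrite {1}(fps_shift_decomp f) mulrDl -mulrA fps_shiftD fps_shiftX.
by rewrite -rmorphM fps_shiftK addr0.
Qed.

Variable F : S.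
Hypothesis F0 : F 0%MM = 0.
Variable c : R.
Hypothesis cF : c * F U_(j)%MM = 1.

(* [u] and [K F] are the coefficients of x_j and 1 in F.  With [w] the degree in
   the variables other than x_j, q |-> - u^-1 (K F) (D q) is a contraction, and
   its affine fixed points are the quotients of the division by F. *)
Lemma linear_division_aux : exists u v (w : 'X_{1..n} -> nat),
  [/\ forall f, D (f * F) = f * u + D f * K F, u * v = 1,
      forall m k, w (m + k)%MM = (w m + w k)%N
    & forall d g, fps_vanish w d g -> fps_vanish w d.+1 (- v * (K F * D g))].
Proof.
have [v uv] : exists v, D F * v = 1.
  by apply: (@fps_inv _ _ _ c); rewrite fps_shiftE add0m.
exists (D F), v, (fun m => \sum_(l | l != j) m l)%N; split=> //.
- move=> f; rewrite {1}(fps_shift_decomp F) mulrDr fps_shiftD mulrCA fps_shiftX.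
  by rewrite fps_shiftM.
- by move=> m k; rewrite -big_split; apply: eq_bigr => l _; rewrite mnmDE.
set w := (w in fps_vanish w); move=> d g gd.
have wD m k : w (m + k)%MM = (w m + w k)%N.
  by rewrite -big_split; apply: eq_bigr => l _; rewrite mnmDE.
have h1 : fps_vanish w 1 (K F).
  move=> m; rewrite ltnS leqn0 sum_nat_eq0 => /forallP wm.
  rewrite fps_restrictE on_face1; case: eqP => // mj.
  suff -> : m = 0%MM by [].
  apply/mnmP => l; rewrite mnm0E; have [->//|lj] := eqVneq l j.
  by apply/eqP; apply: (implyP (wm l)).
have Dg : fps_vanish w d (D g).
  move=> m wm; rewrite fps_shiftE gd // wD [X in (_ + X)%N]big1 ?addn0 // => l lj.
  by rewrite mnm1E eq_sym (negbTE lj).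
have v0 : fps_vanish w 0 (- v) by [].
exact: (fps_vanishM wD v0 (fps_vanishM wD h1 Dg)).
Qed.

Lemma linear_division g : exists q r, g = q * F + r /\ K r = r.
Proof.
have [u [v [w [DF uv wD Tw]]]] := linear_division_aux.
have [|q qE] := fps_fixpoint _ Tw (v * D g).
  by move=> f h; rewrite fps_shiftB; ring.
exists q, (g - q * F); split; first by rewrite addrC subrK.
(* The remainder is free of x_j once D kills it, and the fixed point equation makes 1 - u v a factor
   of its image under D. *)
apply: fps_shift_eq0; rewrite fps_shiftB DF {1}qE.
have -> : D g - ((v * D g + - v * (K F * D q)) * u + D q * K F) =
  (1 - u * v) * (D g - K F * D q) by ring.
by rewrite uv subrr mul0r.
Qed.

(** Here D(q F) = 0 says that q is a fixed point of the homogeneous contraction, so q = 0. *)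
Lemma linear_division_unique q r : K r = r -> r = q * F -> r = 0.
Proof.
move=> Kr rE; have [u [v [w [DF uv wD Tw]]]] := linear_division_aux.
suff q0 : q = 0 by rewrite rE q0 mul0r.
apply: (fps_fixpoint_unique Tw) => //.
have : D r = 0 by rewrite -Kr fps_shiftK.
rewrite rE DF => /(congr1 ( *%R v)); rewrite mulr0 mulrDr => E.
have -> : - v * (K F * D q) = q * (u * v) - (v * (q * u) + v * (D q * K F)) by ring.
by rewrite E uv mulr1 subr0.
Qed.
End LinearDivision.

(** By division, every class modulo F has exactly one representative free of x_j. The map psi
    exchanges x_i and x_j, sets x_j to 0 and reduces modulo F; it is onto with kernel (x_i). *)
Lemma fps_quo_isomorphism (R : comNzRingType) n (i j : 'I_n) (F : fps n R) c :
  F 0%MM = 0 -> c * F U_(j)%MM = 1 ->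
  exists phi : {rmorphism quo (ideal_gen [set F]) -> quo (ideal_gen [set fpsX R i])},
    bijective phi /\
    forall a, phi (quo_proj _ (fpsC n a)) = quo_proj _ (fpsC n a).
Proof.
move=> F0 cF; pose sg := @fps_restrict n R (pred1 j) \o @fps_swap R n i j.
pose psi := quo_proj (ideal_gen [set F]) \o sg.
have sgE g m : sg g m = if m j == 0%N then g (mnm_swap i j m) else 0.
  by rewrite /sg /= on_face1.
have [||phi [bphi phiE]] := @inverse_isomorphism _ _ (ideal_gen [set fpsX R i]) psi.
- move=> u; have [g <-] := quo_proj_surj u.
  have [q [r [gE Kr]]] := linear_division F0 cF g.
  exists (fps_swap i j r); rewrite /psi /sg /= fps_swapK Kr gE.
  apply/quo_eqP; rewrite opprD addrC subrK ideal_gen1.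
  by exists (- q); rewrite mulNr.
- move=> g; change (quo_proj (ideal_gen [set F]) (sg g) = 0 <->
    ideal_set (ideal_gen [set fpsX R i]) g).
  rewrite quo_proj0P !ideal_gen1; split.
    move=> [q sgq]; have sg0 : sg g = 0.
      by apply: (linear_division_unique F0 cF) sgq; exact: fps_restrict_id.
    exists (fps_shift i g); rewrite mulrC {1}(fps_shift_decomp i g).
    rewrite -[RHS]addr0; congr (_ + _); apply: fpsP => m.
    rewrite fps_restrictE on_face1; case: eqP => // mi.
    have := congr1 (fun h : fps n R => h (mnm_swap i j m)) sg0.
    by rewrite sgE mnm_swapK mnmE tpermR mi eqxx.
  move=> [q ->]; exists 0; rewrite mul0r /sg /= !rmorphM.
  suff sgX : sg (fpsX R i) = 0 by move: sgX; rewrite /sg /= => ->; rewrite mulr0.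
  apply: fpsP => m; rewrite sgE fps_coefX; case: eqP => // mj.
  case: eqP => // /(congr1 (fun m : 'X_{1..n} => m i)).
  by rewrite mnmE tpermL mj mnm1E eqxx.
exists phi; split=> // a; rewrite -phiE; congr (phi (quo_proj _ _)).
apply: fpsP => m; rewrite sgE !fps_coefC.
rewrite -{2}(mnm_swap0 i j) (inv_eq (@mnm_swapK _ i j)) mnm_swapK.
by case: eqP => [->|]; rewrite ?mnm0E ?eqxx //; case: ifP.
Qed.

Lemma complete_dvr_noetherian (V : idomainType) (pi : V) :
  complete_dvr pi -> noetherian V.
Proof.
move=> [pid _ _ _]; apply/noetherianP => I /pid[a ->]; exists [:: a].
rewrite -ideal_gen_seq; congr (ideal_set (ideal_gen _)).
by apply/seteqP; split=> x /=; rewrite inE => /eqP.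
Qed.

(** * The series f~ *)

Section Tilde.
Variables (V : idomainType) (pi : V) (n : nat).
Hypothesis noethV : noetherian V.
Hypothesis localV : is_local (ideal_gen [set pi]).
Hypothesis pi_neq0 : pi <> 0.
Implicit Types (f : fps n V) (m : 'X_{1..n.+1}).
Local Notation y := (@ord_max n).
Local Notation xvar := (widen_ord (leqnSn n)).

Lemma unit_principal v : v \is a GRing.unit <-> ~ principal pi v.
Proof.
split=> [vU [c vE]|/(pi_inv noethV localV)[c vc]]; last by apply/unitrPr; exists c.
by apply: (pi_proper localV); exists (v^-1 * c); rewrite -mulrA -vE mulVr.
Qed.

Lemma nunit_principal v : v \isn't a GRing.unit -> principal pi v.
Proof. by move=> vU; apply: contrapT => /unit_principal; exact/negP. Qed.

Lemma pi_expS_principal v k : principal pi (v * pi ^+ k.+1).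
Proof. by exists (v * pi ^+ k); rewrite exprSr mulrA. Qed.

(** Cancelling the power of pi leaves [xget] a single candidate. *)
Lemma fps_tilde_unit f m u : u \is a GRing.unit ->
  f (mnm_x m) = u * pi ^+ (m y) -> fps_tilde pi f m = u.
Proof.
move=> uU fu; rewrite /fps_tilde /=; case: xgetP => [v _ [vU fv]|/(_ u)[]//].
by apply: (mulIf (expf_neq0 (m y) (introN eqP pi_neq0))); rewrite -fv.
Qed.

Lemma fps_tildeP f m : fps_tilde pi f m \is a GRing.unit ->
  f (mnm_x m) = fps_tilde pi f m * pi ^+ (m y).
Proof. by rewrite /fps_tilde /=; case: xgetP => [v _ []//|_]; rewrite unitr0. Qed.

(** A value of [xget] is a chosen unit or the default 0. *)
Lemma fps_tilde_nunit f m : fps_tilde pi f m \isn't a GRing.unit ->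
  fps_tilde pi f m = 0.
Proof. by rewrite /fps_tilde /=; case: xgetP => [v _ [->]|]. Qed.

Lemma mnm_x0 : mnm_x (0%MM : 'X_{1..n.+1}) = 0%MM.
Proof. by apply/mnmP => i; rewrite mnmE !mnm0E. Qed.

Lemma mnm_xy : mnm_x U_(y)%MM = 0%MM.
Proof.
apply/mnmP => i; rewrite mnmE mnm0E mnm1E; apply/eqP; rewrite eqb0.
by rewrite -val_eqE /= gtn_eqF.
Qed.

Lemma mnm_xx i : mnm_x U_(xvar i)%MM = U_(i)%MM.
Proof. by apply/mnmP => j; rewrite mnmE !mnm1E. Qed.

Lemma mnm1_xvar_y i : U_(xvar i)%MM y = 0%N.
Proof. by rewrite mnm1E; apply/eqP; rewrite eqb0 -val_eqE /= ltn_eqF. Qed.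

Lemma var_cases (P : 'I_n.+1 -> Prop) : (forall i, P (xvar i)) -> P y -> forall i, P i.
Proof.
move=> Px Py i; case: (unliftP y i) => [j ->|-> //].
by have -> : lift y j = xvar j; [apply/val_inj; rewrite /= /bump leqNgt ltn_ord|].
Qed.

Lemma fps_tilde0 f : fpsM pi n f -> fps_tilde pi f 0%MM = 0.
Proof.
move=> Mf; apply: fps_tilde_nunit; apply/negP => U.
have /unit_principal := U; apply; have := fps_tildeP U.
by rewrite mnm_x0 mnm0E mulr1 => <-.
Qed.

Lemma order1_tilde_unit f : fpsM pi n f ->
  (~ ideal_pow (fpsM pi n) 2 f <->
   exists i, fps_tilde pi f U_(i)%MM \is a GRing.unit).
Proof.
move=> Mf; split=> [nM2f|[i]].
  apply: contrapT => /forallNP nU; apply: nM2f; apply/fpsM_sqrP => //.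
  split=> [|i].
    have [c f0] := Mf; have /nunit_principal[d cE] : c \isn't a GRing.unit.
      apply/negP => cU; apply: (nU y); rewrite (fps_tilde_unit cU) //.
      by rewrite mnm_xy mnm1E eqxx expr1.
    by exists d; rewrite f0 cE expr2 mulrA.
  apply: nunit_principal; apply/negP => U; apply: (nU (xvar i)).
  by rewrite (fps_tilde_unit U) // mnm_xx mnm1_xvar_y mulr1.
move=> /[swap] /(fpsM_sqrP pi_neq0)[[c f0] f1]; move: i; apply: var_cases => [i|] U.
  have := fps_tildeP U; rewrite mnm_xx mnm1_xvar_y mulr1 => fE.
  by have /unit_principal := U; rewrite -fE; apply.
have := fps_tildeP U; rewrite mnm_xy mnm1E eqxx expr1 f0 expr2 mulrA.
move=> /(mulIf (introN eqP pi_neq0)) cE.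
by have /unit_principal := U; apply; exists c.
Qed.

(** The constant term of f~ is 0, so only the linear coefficients decide membership in the
    square. *)
Lemma fps_tilde_order1 f : fpsM pi n f ->
  (~ ideal_pow (fpsM pi n.+1) 2 (fps_tilde pi f) <->
   exists i, fps_tilde pi f U_(i)%MM \is a GRing.unit).
Proof.
move=> Mf; split=> [nM2|[i /unit_principal U] /(fpsM_sqrP pi_neq0)[_ /(_ i)//]].
apply: contrapT => /forallNP nU; apply: nM2; apply/fpsM_sqrP => //.
split=> [|i]; first by rewrite fps_tilde0 //; exact: (ideal0 (principal_ideal _)).
by apply: nunit_principal; apply/negP.
Qed.

Lemma fps_tildeX i : fps_tilde pi (fpsX V i) = fpsX V (xvar i).
Proof.
apply: fpsP => m; rewrite [RHS]fps_coefX.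
case: eqP => [->|mi]; first by rewrite (fps_tilde_unit (unitr1 V)) // fps_coefX
  mnm_xx eqxx mnm1_xvar_y mulr1.
apply: fps_tilde_nunit; apply/negP => U.
have := fps_tildeP U; rewrite fps_coefX; case: eqP => [mE|_].
  (* Here m stands for x_i times a power of y. Exponent 0 gives the excluded monomial x_i; a
     positive exponent would make 1 divisible by pi. *)
  case my: (m y) => [|k].
    case: mi; apply/mnmP; apply: var_cases => [j|].
      have := congr1 (fun m : 'X_{1..n} => m j) mE.
      by rewrite mnmE => ->; rewrite !mnm1E.
    by rewrite my mnm1_xvar_y.
  by move=> E; apply: (pi_proper localV); rewrite [1]E; exact: pi_expS_principal.
move/esym/eqP; rewrite mulf_eq0 expf_eq0 => /orP[/eqP U0|/andP[_ /eqP//]].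
by move: U; rewrite U0 unitr0.
Qed.

Lemma has_order1 f : fpsM pi n f ->
  (has_order pi f (Some 1%N) <-> ~ ideal_pow (fpsM pi n) 2 f).
Proof.
have IM := fpsM_ideal pi n.
have powE k : ideal_pow (fps_max_ideal pi n) k = ideal_pow (fpsM pi n) k.
  by rewrite fps_max_idealE.
move=> Mf; split=> [[_ max1] M2f|nM2f]; last first.
  split=> [|[|[|j]]] //.
    by change (ideal_pow (fps_max_ideal pi n) 1 f); rewrite powE ideal_pow1.
  change (ideal_pow (fps_max_ideal pi n) j.+2 f -> (j.+2 <= 1)%N); rewrite powE => fj.
  exfalso; apply: nM2f; elim: j fj => [//|j IH] fj; apply: IH.
  exact: ideal_pow_anti fj.
have : ideal_pow (fps_max_ideal pi n) 2 f by rewrite powE.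
by move=> /max1.
Qed.

Section Quotient.
Variables (k : nat) (F : fps k V).
Hypothesis MF : fpsM pi k F.
Local Notation p := (quo_proj (ideal_gen [set F])).

Lemma sub_fpsM : ideal_set (ideal_gen [set F]) `<=` fpsM pi k.
Proof. by apply: ideal_gen_sub; [exact: fpsM_ideal|move=> _ ->]. Qed.

Lemma quo_fps_local : is_local (p @` fpsM pi k).
Proof.
apply: quo_local; [exact: fpsM_ideal|exact: fpsM1|exact: fpsM_inv|exact: sub_fpsM].
Qed.
End Quotient.

Lemma regular_order1 f : fpsM pi n f -> f <> 0 ->
  (regular_local_ring (quo (ideal_gen [set f])) <-> ~ ideal_pow (fpsM pi n) 2 f).
Proof.
move=> Mf f0; have fdim := quo_krull_dim noethV localV pi_neq0 Mf f0.
split=> [[_ [M [d [lM [[c cc] _] [z ME]]]]] M2f|nM2f].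
  have dn : (d <= n)%N by apply: fdim.2; exists c.
  have := quo_generators_bound (fpsM_gen pi n) (fpsM1 localV) (w := z)
    (fpsM_indep pi_neq0) M2f.
  rewrite -(local_unique (quo_fps_local Mf) lM) => /(_ ME).
  by rewrite leqNgt ltnS dn.
split; first exact/quo_noetherian/fps_noetherian.
have [w wE] := quo_generators (fpsM_gen pi n)
  (@fpsM_inv _ _ _ noethV localV) Mf nM2f.
by exists (quo_proj (ideal_gen [set f]) @` fpsM pi n), n; split=> //;
  [exact: quo_fps_local|exists w].
Qed.

Lemma sim_of_unit f (i : 'I_n) : fpsM pi n f ->
  (exists j, fps_tilde pi f U_(j)%MM \is a GRing.unit) -> fps_sim pi f (fpsX V i).
Proof.
move=> Mf [j U]; rewrite /fps_sim fps_tildeX.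
by apply: (fps_quo_isomorphism _ (fps_tilde0 Mf) (mulVr U)).
Qed.

Lemma unit_of_sim f (i : 'I_n) : fpsM pi n f -> fps_sim pi f (fpsX V i) ->
  exists j, fps_tilde pi f U_(j)%MM \is a GRing.unit.
Proof.
move=> Mf; rewrite /fps_sim fps_tildeX => -[phi [bphi _]].
set F := fps_tilde pi f in phi bphi *; set X := fpsX V (xvar i) in phi bphi *.
have MF : fpsM pi n.+1 F.
  rewrite /fpsM /= -[xget _ _]/(F 0%MM) fps_tilde0 //.
  exact: (ideal0 (principal_ideal _)).
have MX : fpsM pi n.+1 X.
  by rewrite /fpsM /= eq_sym mnm1_eq0; exact: (ideal0 (principal_ideal _)).
have nM2X : ~ ideal_pow (fpsM pi n.+1) 2 X.
  move=> /(fpsM_sqrP pi_neq0)[_ /(_ (xvar i))].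
  by rewrite fps_coefX eqxx; exact: pi_proper.
apply/(fps_tilde_order1 Mf) => M2F.
have [w wE] := quo_generators (fpsM_gen pi n.+1)
  (@fpsM_inv _ _ _ noethV localV) MX nM2X.
have [psi phiK psiK] := bphi.
have phi_surj b : exists a, phi a = b by exists (psi b).
set MFq := quo_proj (ideal_gen [set F]) @` fpsM pi n.+1.
have lMF : is_local MFq by exact: quo_fps_local.
have nSF := @quo_noetherian _ (ideal_gen [set F]) (@fps_noetherian _ n.+1 noethV).
have IMF : is_ideal MFq by apply: image_ideal (fpsM_ideal _ _); exact: quo_proj_surj.
have phi_mem u : (phi @` MFq) (phi u) <-> MFq u.
  by split=> [[v Mv /(can_inj phiK) <-]|Mu] //; exists u.
(* Uniqueness of the maximal ideal then identifies this image with the maximal ideal of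
   V[[x,y]]/x_i, which has n+1 generators. *)
have lphi : is_local (phi @` MFq).
  apply: is_localP; first exact: image_ideal.
    rewrite -(rmorph1 phi) phi_mem; have [[_ nT _] _] := lMF.
    exact: proper_ideal nT.
  move=> b; rewrite -(psiK b) phi_mem => /(local_inv nSF lMF)[v uv].
  by exists (phi v); rewrite -rmorphM uv rmorph1.
have phiM : phi @` MFq = ideal_gen (range w).
  by rewrite -wE; apply: local_unique => //; exact: quo_fps_local.
(* As [psi] is only a set-theoretic inverse, the generators are pulled back along it, but ideals are
   compared through their images under [phi]. *)
have rw : range w = phi @` range (psi \o w).
  apply/seteqP; split=> [_ [l _ <-]|_ [_ [l _ <-] <-]]; last by exists l; rewrite //= psiK.
  by exists (psi (w l)); [exists l|rewrite psiK].
have := quo_generators_bound (fpsM_gen pi n.+1) (fpsM1 localV) (w := psi \o w)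
  (fpsM_indep pi_neq0) M2F.
rewrite ltnn => H; suff : false by []; apply: H; rewrite -/MFq.
apply/seteqP; split=> u.
  move=> /phi_mem; rewrite phiM rw -image_ideal_gen // => -[v + /(can_inj phiK) <-].
  exact.
move=> uw; apply/phi_mem; rewrite phiM rw -image_ideal_gen //; by exists u.
Qed.

(** The value 0 could also arise in the one-dimensional case, as a length. If no linear coefficient
    is a unit, this is excluded because f~, its derivatives and a all lie in the maximal ideal, so
    the quotient is nonzero. *)
Lemma tau_unit f : fpsM pi n f -> (has_tau pi f (Some 0%N) <->
  exists j, fps_tilde pi f U_(j)%MM \is a GRing.unit).
Proof.
move=> Mf; set F := fps_tilde pi f; have F0 : F 0%MM = 0 := fps_tilde0 Mf.
have deriv0 j : fps_deriv j F 0%MM = F U_(j)%MM.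
  by rewrite /fps_deriv [LHS]/= mnm0E mulr1n add0m.
split=> [|[j U]]; last first.
  constructor 1; split=> //; apply/eqP; rewrite eq_sym; apply/eqP.
  rewrite -(rmorph1 (quo_proj (tjurina_ideal pi f))); apply/quo_proj0P.
  have [|h dh] := @fps_inv _ _ (fps_deriv j F) (F U_(j)%MM)^-1.
    by rewrite deriv0 mulVr.
  rewrite -dh; apply: (idealMr _ (idealP _)); apply: ideal_genS; left.
  by apply: ideal_genS; exists j.
apply: contraPP => /forallNP nU.
have FU j : F U_(j)%MM = 0 by apply: fps_tilde_nunit; apply/negP.
have IM := fpsM_ideal pi n.+1.
have Mg (g : fps n.+1 V) : g 0%MM = 0 -> fpsM pi n.+1 g.
  by move=> g0; rewrite /fpsM /= g0; exact: (ideal0 (principal_ideal _)).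
have MF : fpsM pi n.+1 F by exact: Mg.
have MJ : ideal_set (jacobian pi f) `<=` fpsM pi n.+1.
  by apply: ideal_gen_sub => // _ [j _ <-]; apply: Mg; rewrite deriv0.
have MT : ideal_set (tjurina_ideal pi f) `<=` fpsM pi n.+1.
  by apply: ideal_gen_sub => // g [/MJ|->].
have M1 := @fpsM1 V pi n.+1 localV.
case=> [[B0 _]|[_ [a [M lM [[_ aM _] _]] [[c [c0 cT _ _]] _]]]|[]//].
  apply: M1; apply: MT; apply/quo_proj0P.
  by rewrite rmorph1; rewrite -B0.
(* A reduction is contained in the ideal it reduces, so a unit a would put 1 into the maximal ideal
   of B. *)
have Ma : fpsM pi n.+1 a.
  apply: contrapT => /(fpsM_inv noethV localV)[b ab].
  have [[IMq nT _] _] := lM; apply: (proper_ideal IMq nT).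
  rewrite -(rmorph1 (quo_proj (tjurina_ideal pi f))) -ab rmorphM.
  by apply: (idealMr _ IMq); apply: aM; exact: ideal_genS.
set L := ideal_gen _ in c c0 cT.
have ML : ideal_set L `<=` fpsM pi n.+1.
  by apply: ideal_gen_sub => // g [/MJ//|[->|->]].
apply: M1; apply: ML; apply/quo_proj0P.
(* A chain of length 0 starts and ends at the same submodule, so the zero submodule would be
   everything. *)
have : c 0%N (quo_proj L 1) by rewrite cT.
by rewrite c0.
Qed.

End Tilde.

(** The series 0 is excluded by [hf0]: its quotient V[[x]] is regular, but its order is infinite. *)
Theorem proposition3p14 (V : idomainType) (pi : V) (n : nat) (hn : (0 < n)%N)
  (f : fps n V) (hV : complete_dvr pi) (hf : ideal_set (fps_max_ideal pi n) f)
  (hf0 : f <> 0) :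
  [<-> regular_local_ring (quo (ideal_gen [set f]));
       has_order pi f (Some 1%N);
       fps_sim pi f (fpsX V (Ordinal hn));
       has_tau pi f (Some 0%N)].
Proof.
have nV := complete_dvr_noetherian hV; have [_ lV pi0 _] := hV.
have Mf : fpsM pi n f by rewrite -fps_max_idealE.
have tildeP := order1_tilde_unit nV lV pi0 Mf.
tfae.
- by move=> /(regular_order1 nV lV pi0 Mf hf0)/(has_order1 Mf).
- by move=> /(has_order1 Mf)/tildeP; exact: sim_of_unit.
- by move=> /(unit_of_sim nV lV pi0 Mf)/(tau_unit nV lV Mf).
- by move=> /(tau_unit nV lV Mf)/tildeP/(regular_order1 nV lV pi0 Mf hf0).
Qed.
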